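(* Assume $A:=\max_{x\in\mathcal X}|\mathcal A(x)|\ge 2$ and let $\mu^s$ be a positive sampling policy. Run LocalOMD (as defined in the context) with $\mu^1$ the uniform policy ($\mu^1(a|x)=1/|\mathcal A(x)|$), with $\Psi_x(p)=\sum_{a\in\mathcal A(x)}p(a)\log p(a)$ (the negative Shannon entropy on $\mathbb R_{\ge0}^{|\mathcal A(x)|}$, so that $D_x$ is the Kullback–Leibler divergence on the simplex), and with the constant learning rates $\eta^t(x)=\eta/\kappa(\mu^s|x)$ for all $t$ and $x$, where $\eta=\sqrt{\log(A)\,\kappa(\mu^s)/(3HT)}$. Then for every $\delta\in(0,1)$, with probability at least $1-\delta$, \[\mathcal R^T_{\min}\le (4+2\sqrt3)\,H^{3/2}\sqrt{\log(A)\,\iota\,\kappa(\mu^s)\,T},\qquad \iota=\log\big(2(A_{\mathcal X}+1)/\delta\big).\]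
   Context: Game structure. Fix an integer $H\ge1$. The min-player's information sets form a finite set $\mathcal X$; each $x\in\mathcal X$ has a depth $h(x)\in\{1,\dots,H\}$ and a finite nonempty action set $\mathcal A(x)$. Perfect recall: every $x$ of depth $h$ has a unique history $(x_1,a_1,\dots,x_{h-1},a_{h-1},x_h=x)$ with $x_i$ of depth $i$ and $a_i\in\mathcal A(x_i)$, and the history of any $x'$ whose history contains $x$ extends the history of $x$. We say $x'$ directly follows $(x,a)$ if $h(x')=h(x)+1$ and the history of $x'$ contains $x$ followed by action $a$; we say $x$ is in the history of $x'$ if $x=x'_i$ for some $i$ (including $x=x'$). $\mathcal X_1$ is the set of depth-1 information sets, $A_{\mathcal X}=\sum_{x}|\mathcal A(x)|$. A policy is $\mu=(\mu(\cdot|x))_{x\in\mathcal X}$ with $\mu(\cdot|x)\in\Delta_{\mathcal A(x)}$ (probability simplex); $\Pi_{\min}$ is the set of policies; $\mu$ is positive if $\mu(a|x)>0$ for all $x,a$. For $x$ of depth $h$ with history $(x_1,a_1,\dots,x_h=x)$ and $a\in\mathcal A(x)$, putting $a_h=a$, the realization plan is $\mu_{1:}(x,a)=\prod_{i=1}^h\mu(a_i|x_i)$ and $\mu_{1:}(x)=\sum_{a}\mu_{1:}(x,a)=\prod_{i=1}^{h-1}\mu(a_i|x_i)$. For $x$ of depth $h$ and $(x',a')$ with $x$ in the history of $x'$, $x'$ of depth $h'$ with history $(x'_1,a'_1,\dots,x'_{h'})$ and $a'_{h'}=a'$, set $\mu_{h:}(x',a')=\prod_{i=h}^{h'}\mu(a'_i|x'_i)$.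 $\langle\cdot,\cdot\rangle$ is the standard inner product on $\mathbb R^{A_{\mathcal X}}$ indexed by pairs $(x,a)$. Complexity quantities. For positive $\mu^s$: $\kappa(\mu^s)=\max_{\mu\in\Pi_{\min}}\sum_{x\in\mathcal X}\sum_{a\in\mathcal A(x)}\mu_{1:}(x,a)/\mu^s_{1:}(x,a)$, and for $x$ of depth $h$, $\kappa(\mu^s|x)=\max_{\mu\in\Pi_{\min}}\sum_{x':\,x\text{ in history of }x'}\sum_{a'\in\mathcal A(x')}\mu_{h:}(x',a')/\mu^s_{h:}(x',a')$. Episodes and learning protocol. For each max-player policy $\nu$ there are numbers $p^\nu_{1:}(x)\in[0,1]$ and $\ell^\nu_h(x,a)\in[0,1]$ ($x$ of depth $h$) such that an episode played with min-player policy $\mu$ against $\nu$ produces a random trajectory $(x_1,a_1,\ell_1,\dots,x_H,a_H,\ell_H)$ with $x_h$ of depth $h$, $a_h\in\mathcal A(x_h)$ drawn from $\mu(\cdot|x_h)$ conditionally on the past, $\ell_h\in[0,1]$, and for every $x$ of depth $h$ and $a\in\mathcal A(x)$: $\mathbb P(x_h=x,a_h=a)=p^\nu_{1:}(x)\mu_{1:}(x,a)$ and $\mathbb E[\ell_h\mathbf 1\{x_h=x,a_h=a\}]=p^\nu_{1:}(x)\mu_{1:}(x,a)\ell^\nu_h(x,a)$. Define $\ell^\nu(x,a)=p^\nu_{1:}(x)\ell^\nu_h(x,a)$ (so the expected total loss is $\langle\ell^\nu,\mu_{1:}\rangle$). Fix a positive sampling policy $\mu^s$ and a filtration $(\mathcal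 F^t)_{t=0}^T$. At each round $t=1,\dots,T$, a max-player policy $\nu^t$ and a min-player policy $\mu^t$ are $\mathcal F^{t-1}$-measurable; conditionally on $\mathcal F^{t-1}$, the min-player observes a trajectory $(x^t_h,a^t_h,\ell^t_h)_{h\le H}$ distributed as an episode played with $(\mu^s,\nu^t)$, and this trajectory is $\mathcal F^t$-measurable. Set $\ell^t=\ell^{\nu^t}$ and $\mathcal R^T_{\min}=\max_{\mu^\dagger\in\Pi_{\min}}\sum_{t=1}^T\langle\ell^t,\mu^t_{1:}-\mu^\dagger_{1:}\rangle$. LocalOMD. For each $x$, $\Psi_x$ is a Legendre function on a closed convex set $\overline{\Omega_x}\subset\mathbb R^{|\mathcal A(x)|}_{\ge0}$ containing $\Delta_{\mathcal A(x)}$, with Bregman divergence $D_x(p,q)=\Psi_x(p)-\Psi_x(q)-\langle\nabla\Psi_x(q),p-q\rangle$. Learning rates $\eta^t(x)>0$ ($t=1,\dots,T+1$) are non-increasing in $t$, $\eta^{t+1}(x)$ is $\mathcal F^t$-measurable, and $\eta^{t+1}(x)=\eta^t(x)$ whenever $x\ne x^t_{h(x)}$. Given $\mu^1$ with each $\mu^1(\cdot|x)$ in the interior $\Omega_x$, at round $t$: set $q^t_{H+1}=0$; for $h=H,\dots,1$, with $x=x^t_h$, let $\tilde\ell^t_h\in\mathbb R^{\mathcal A(x)}$, $\tilde\ell^t_h(a)=\mathbf 1\{a=a^t_h\}(\ell^t_h+q^t_{h+1})/\mu^s(a^t_h|x)$, let $h^t_x(p)=\langle\tilde\ell^t_h,p\rangle+\frac1{\eta^t(x)}D_x(p,\mu^t(\cdot|x))+\big(\frac1{\eta^{t+1}(x)}-\frac1{\eta^t(x)}\big)D_x(p,\mu^1(\cdot|x))$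 for $p\in\Delta_{\mathcal A(x)}$, and set $\mu^{t+1}(\cdot|x)=\arg\min_{p\in\Delta_{\mathcal A(x)}}h^t_x(p)$, $q^t_h=\min_{p\in\Delta_{\mathcal A(x)}}h^t_x(p)$; for every $x$ not on the trajectory, $\mu^{t+1}(\cdot|x)=\mu^t(\cdot|x)$. The min-player plays this sequence $(\mu^t)$. *)

(* Defs.v *)
From HB Require Import structures.
From mathcomp Require Import all_boot all_order all_algebra.
From mathcomp Require Import all_classical all_reals all_analysis.
Set Implicit Arguments. Unset Strict Implicit. Unset Printing Implicit Defensive.
Import Order.TTheory GRing.Theory Num.Theory.
Local Open Scope classical_set_scope.
Local Open Scope ring_scope.

(** * Game structure (min-player's information sets)
   [X] : information sets, [Act] : a global finite type of action labels,
   [acts x] : the action set A(x) (a nonempty subset of Act),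
   [depth x] : h(x),
   [parent x] : [None] if h(x)=1, [Some (y,a)] if x directly follows (y,a).
   With perfect recall the history of x is obtained by iterating [parent]. *)
Section Game.
Variables (X Act : finType) (H : nat) (depth : X -> nat)
          (acts : X -> {set Act}) (parent : X -> option (X * Act)).

Definition wf_game : Prop :=
  [/\ (1 <= H)%N,
      (forall x, 1 <= depth x <= H)%N,
      (forall x, 0 < #|acts x|)%N,
      (forall x, parent x = None <-> depth x = 1%N) &
      (forall x y a, parent x = Some (y, a) ->
          (depth y).+1 = depth x /\ a \in acts y)].

Fixpoint hist_fuel (n : nat) (x : X) : seq (X * Act) :=
  match n with
  | 0 => [::]
  | n'.+1 => match parent x with
             | None => [::]
             | Some (y, a) => (y, a) :: hist_fuel n' y
             end
  end.

Definition hist (x : X) : seq (X * Act) := hist_fuel (depth x) x.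

Definition in_hist (x x' : X) : bool :=
  (x == x') || has (fun p => p.1 == x) (hist x').

Definition follows (x' x : X) (a : Act) : Prop := parent x' = Some (x, a).

Definition Amax : nat := (\max_(x : X) #|acts x|)%N.
Definition AX : nat := (\sum_(x : X) #|acts x|)%N.

Variable R : realType.

Definition in_simplex (S : {set Act}) (p : Act -> R) : Prop :=
  (forall a, a \in S -> 0 <= p a) /\ \sum_(a in S) p a = 1.

(** policies: only the values on A(x) matter *)
Definition policy (mu : X -> Act -> R) : Prop := forall x, in_simplex (acts x) (mu x).

Definition positive_policy (mu : X -> Act -> R) : Prop :=
  policy mu /\ forall x a, a \in acts x -> 0 < mu x a.

Definition uniform_policy (mu : X -> Act -> R) : Prop :=
  forall x a, a \in acts x -> mu x a = #|acts x|%:R^-1.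

Definition real_plan (mu : X -> Act -> R) (x : X) : R :=
  \prod_(p <- hist x) mu p.1 p.2.
Definition real_plan_a (mu : X -> Act -> R) (x : X) (a : Act) : R :=
  real_plan mu x * mu x a.
(** mu_{h:}(x',a') for x (of depth h) in the history of x' *)
Definition real_plan_from (mu : X -> Act -> R) (x x' : X) (a' : Act) : R :=
  (\prod_(p <- hist x' | (depth x <= depth p.1)%N) mu p.1 p.2) * mu x' a'.

Definition inner (l m : X -> Act -> R) : R :=
  \sum_(x : X) \sum_(a in acts x) l x a * m x a.

(** complexity quantities (the max over the compact set of policies is
    attained, so it coincides with the supremum) *)
Definition kappa (ms : X -> Act -> R) : R :=
  sup [set s | exists mu, policy mu /\
        s = \sum_(x : X) \sum_(a in acts x) real_plan_a mu x a / real_plan_a ms x a].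

Definition kappa_at (ms : X -> Act -> R) (x : X) : R :=
  sup [set s | exists mu, policy mu /\
        s = \sum_(x' : X | in_hist x x') \sum_(a' in acts x')
               real_plan_from mu x x' a' / real_plan_from ms x x' a'].

Definition negent (S : {set Act}) (p : Act -> R) : R :=
  \sum_(a in S) p a * ln (p a).
Definition bregman_kl (S : {set Act}) (p q : Act -> R) : R :=
  negent S p - negent S q - \sum_(a in S) (ln (q a) + 1) * (p a - q a).

End Game.

Definition Fmeas_real (Om : Type) (R : realType) (G : set (set Om)) (f : Om -> R) : Prop :=
  forall B : set R, measurable B -> G (f @^-1` B).
Definition Fmeas_fin (Om : Type) (T : Type) (G : set (set Om)) (f : Om -> T) : Prop :=
  forall v : T, G [set w | f w = v].

Local Open Scope ereal_scope.

Section Protocol.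
Variables (X Act : finType) (H : nat) (depth : X -> nat)
          (acts : X -> {set Act}) (parent : X -> option (X * Act)).
Variables (R : realType) (d : measure_display) (Om : measurableType d)
          (P : probability Om R).

Definition filtration (F : nat -> set (set Om)) : Prop :=
  forall t, [/\ sigma_algebra setT (F t), F t `<=` measurable & F t `<=` F t.+1].

Definition past_sigma (F : nat -> set (set Om))
    (xs : nat -> nat -> Om -> X) (as_ : nat -> nat -> Om -> Act)
    (ls : nat -> nat -> Om -> R) (t h : nat) : set (set Om) :=
  <<s F t.-1 `|`
      [set E | exists i v, (1 <= i <= h)%N /\ E = [set w | xs t i w = v]] `|`
      [set E | exists i v, (1 <= i < h)%N /\ E = [set w | as_ t i w = v]] `|`
      [set E | exists i (B : set R), (1 <= i < h)%N /\ measurable B /\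
                                     E = ls t i @^-1` B] >>.

(** Protocol: at round t (1 <= t <= T), conditionally on F^{t-1}, the observed
    trajectory (xs t h, as t h, ls t h)_{h<=H} is distributed as an episode
    played with (ms, nu t); it is F^t-measurable. The max-player policies are
    elements of [V], with associated numbers [pV nu x] = p^nu_{1:}(x) and
    [lV nu x a] = l^nu_{h(x)}(x,a). *)
Definition protocol (F : nat -> set (set Om)) (T : nat)
    (V : Type) (pV : V -> X -> R) (lV : V -> X -> Act -> R)
    (nu : nat -> Om -> V) (ms : X -> Act -> R)
    (xs : nat -> nat -> Om -> X) (as_ : nat -> nat -> Om -> Act)
    (ls : nat -> nat -> Om -> R) : Prop :=
  forall t, (1 <= t <= T)%N ->
  [/\ (forall x, Fmeas_real (F t.-1) (fun w => pV (nu t w) x)),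
      (forall x a, Fmeas_real (F t.-1) (fun w => lV (nu t w) x a)) &
  forall h, (1 <= h <= H)%N ->
  [/\ (forall w, depth (xs t h w) = h /\ as_ t h w \in acts (xs t h w)
                 /\ (0 <= ls t h w <= 1)%R),
      (forall w, (h < H)%N -> parent (xs t h.+1 w) = Some (xs t h w, as_ t h w)),
      [/\ Fmeas_fin (F t) (xs t h), Fmeas_fin (F t) (as_ t h)
        & Fmeas_real (F t) (ls t h)],
      (* a_h is drawn from ms(.|x_h) conditionally on the past *)
      (forall E a, past_sigma F xs as_ ls t h E ->
         P (E `&` [set w | as_ t h w = a]) =
         \int[P]_(w in E) (ms (xs t h w) a)%:E) &
      (forall B x a, F t.-1 B -> depth x = h -> a \in acts x ->
         P (B `&` [set w | xs t h w = x /\ as_ t h w = a]) =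
           \int[P]_(w in B) (pV (nu t w) x * real_plan_a depth parent ms x a)%:E
         /\
         \int[P]_(w in B `&` [set w | xs t h w = x /\ as_ t h w = a]) (ls t h w)%:E =
           \int[P]_(w in B)
              (pV (nu t w) x * real_plan_a depth parent ms x a * lV (nu t w) x a)%:E)]].

Definition omd_obj (S : {set Act}) (lt : Act -> R) (eta_t eta_t1 : R)
    (mut mu1 : Act -> R) (p : Act -> R) : R :=
  (\sum_(a in S) lt a * p a + eta_t^-1 * bregman_kl S p mut
    + (eta_t1^-1 - eta_t^-1) * bregman_kl S p mu1)%R.

Definition loss_est (ms : X -> Act -> R) (x : X) (ah : Act) (lh qnext : R)
    : Act -> R :=
  fun a => if a == ah then ((lh + qnext) / ms x ah)%R else 0%R.

Definition localOMD (F : nat -> set (set Om)) (T : nat)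
    (ms : X -> Act -> R) (lr : nat -> X -> R)
    (xs : nat -> nat -> Om -> X) (as_ : nat -> nat -> Om -> Act)
    (ls : nat -> nat -> Om -> R)
    (mu : nat -> Om -> X -> Act -> R) (q : nat -> nat -> Om -> R) : Prop :=
  [/\ (forall w, uniform_policy acts (mu 1%N w)),
      (forall t w, (1 <= t <= T.+1)%N -> policy acts (mu t w)),
      (forall t x a, (1 <= t <= T)%N -> Fmeas_real (F t.-1) (fun w => mu t w x a)),
      (forall t w, (1 <= t <= T)%N -> q t H.+1 w = 0%R) &
   forall t w, (1 <= t <= T)%N ->
   (forall h, (1 <= h <= H)%N ->
      let x := xs t h w in
      let obj := omd_obj (acts x)
                   (loss_est ms x (as_ t h w) (ls t h w) (q t h.+1 w))
                   (lr t x) (lr t.+1 x) (mu t w x) (mu 1%N w x) in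
      [/\ in_simplex (acts x) (mu t.+1 w x),
          (forall p, in_simplex (acts x) p -> (obj (mu t.+1 w x) <= obj p)%R) &
          q t h w = obj (mu t.+1 w x)])
   /\ (forall x, x != xs t (depth x) w ->
         forall a, a \in acts x -> mu t.+1 w x a = mu t w x a)].

Definition regret (T : nat) (V : Type) (pV : V -> X -> R) (lV : V -> X -> Act -> R)
    (nu : nat -> Om -> V) (mu : nat -> Om -> X -> Act -> R) (w : Om) : R :=
  sup [set s | exists md, policy acts md /\
    s = (\sum_(1 <= t < T.+1)
          inner acts (fun x a => pV (nu t w) x * lV (nu t w) x a)
                     (fun x a => real_plan_a depth parent (mu t w) x a
                                 - real_plan_a depth parent md x a))%R].

End Protocol.

(* Main.v *)
Require Import Defs.
From HB Require Import structures.
From mathcomp Require Import all_boot all_order all_algebra.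
From mathcomp Require Import all_classical all_reals all_analysis.
From mathcomp Require Import measurable_realfun ring lra.
Set Implicit Arguments. Unset Strict Implicit. Unset Printing Implicit Defensive.
Import Order.TTheory GRing.Theory Num.Theory.
Import numFieldNormedType.Exports.
Local Open Scope classical_set_scope.
Local Open Scope ring_scope.

(** Write r(x,a) = mu^t_{1:}(x,a) / mu^s_{1:}(x,a), and let Z^t be the sum of r
   along the observed trajectory, Zhat^t the same sum weighted by the observed
   losses.  Each local step is an exact entropic step, so the three-point
   identity, weighted by ratios of realization plans, telescopes along the
   trajectory: Zhat^t minus the importance-weighted loss of a comparator is a
   sum of local divergences that telescopes over t, plus an error which, thanks
   to the choice eta / kappa(mu^s|x), is at most (eta/2) H Z^t pathwise.  The
   divergences contribute at most H kappa(mu^s) log A / eta, because policies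
   below the information sets of a given depth can be glued to the comparator.

   The stochastic part needs three exponential supermartingales: one for
   <l^t, mu^t> - Zhat^t (second moment at most kappa H, since Zhat^t <= Z^t <=
   kappa and E Z^t <= H), one for Z^t, and one for each pair (x,a) comparing the
   observed loss at (x,a) with its conditional mean, scaled by mu^s_{1:}(x,a).
   The bound E Z^t <= H holds because the protocol forces p^nu_{1:} to be a
   sub-flow on the tree almost surely.  If iota kappa > H T, the trivial bound
   H T on the regret suffices. *)

(** * Entropic mirror steps *)

(** The comparator in the regret is chosen in hindsight, so no martingale bound applies to it
    directly. Its importance-weighted loss is linear in the cumulated observed losses at the pairs
    (x,a), with nonnegative coefficients that sum to at most kappa. One deviation bound per pair
    therefore serves all comparators at once, and the number of pairs enters only through iota. The
    policy mu^t is known before round t, so its own loss is treated as a single variable.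

    Conditional expectations occur in integrated form: an identity given F^{t-1} is tested against
    bounded F^{t-1}-measurable weights. The sub-flow inequalities obtained in this way hold only
    almost surely, and a null set has to be carried along. Probability bounds are phrased with a
    measurable exceptional set, since the inequalities themselves are not shown to define measurable
    events.

    The condition iota kappa <= H T does two things: it makes the scale sqrt(iota kappa / (H T)) of
    the bounds per pair at most 1, and it lets the deviation kappa iota of the sum of the Z^t be
    absorbed by its mean part, of order H T. *)

Section ExpBounds.
Variable R : realType.
Implicit Type x : R.

Lemma ge0_derive_ge0 (f df : R -> R) x : (forall y : R, is_derive y 1 f (df y)) ->
  (forall y, 0 <= y -> 0 <= df y) -> f 0 = 0 -> 0 <= x -> 0 <= f x.
Proof.
move=> fd df0 f0 x0.
have [|c] := @MVT_segment R f df 0 x x0 (fun y _ => fd y).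
  apply: continuous_subspaceT => y.
  by apply: differentiable_continuous; apply/derivable1_diffP; case: (fd y).
rewrite in_itv /= => /andP[c0 _].
by rewrite f0 !subr0 => ->; rewrite mulr_ge0// df0.
Qed.

Lemma expRN_le2 x : 0 <= x -> expR (- x) <= 1 - x + x ^+ 2 / 2.
Proof.
move=> x0; rewrite -subr_ge0.
apply: (@ge0_derive_ge0 (fun y => 1 - y + y ^+ 2 / 2 - expR (- y))
  (fun y => - 1 + y + expR (- y))) => // [y|y y0|].
- apply: is_derive_eq; rewrite /GRing.scale /=; lra.
- by have := expR_ge1Dx (- y); lra.
- by rewrite oppr0 expR0; lra.
Qed.

Lemma expRN_ge3 x : 0 <= x -> 1 - x + x ^+ 2 / 2 - x ^+ 3 / 6 <= expR (- x).
Proof.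
move=> x0; rewrite -subr_ge0.
apply: (@ge0_derive_ge0 (fun y => expR (- y) - (1 - y + y ^+ 2 / 2 - y ^+ 3 / 6))
  (fun y => 1 - y + y ^+ 2 / 2 - expR (- y))) => // [y|y y0|].
- apply: is_derive_eq; rewrite /GRing.scale /=; lra.
- by rewrite subr_ge0 expRN_le2.
- by rewrite oppr0 expR0; lra.
Qed.

Lemma expR_le2 x : 0 <= x <= 1 -> expR x <= 1 + x + x ^+ 2.
Proof.
move=> /andP[x0 x1]; rewrite -[x in expR x]opprK expRN.
rewrite -ler_pV2 ?inE ?unitfE ?invr_eq0 ?invr_gt0 ?gt_eqF ?expR_gt0//=; last first.
- by have := sqr_ge0 x; lra.
- by have := sqr_ge0 x; lra.
rewrite invrK; apply: le_trans (expRN_ge3 x0).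
have h : 0 < 1 + x + x ^+ 2 by have := sqr_ge0 x; lra.
rewrite -div1r ler_pdivrMr//.
(* The product of [1 + x + x ^+ 2] with the cubic lower bound for [expR (- x)] exceeds 1 by exactly
   this quantity. *)
have : 0 <= x ^+ 2 * ((1 - x) * (1 / 2 - x / 6 + x ^+ 2 / 6)).
  by apply: mulr_ge0; [exact: sqr_ge0|apply: mulr_ge0; have := sqr_ge0 x; lra].
nra.
Qed.

End ExpBounds.

(** * Kullback-Leibler divergence and the closed form of the entropic step *)

Section KL.
Variables (R : realType) (Act : finType) (S : {set Act}).
Implicit Types (p q l : Act -> R).

Lemma in_simplex_le1 p a : in_simplex S p -> a \in S -> p a <= 1.
Proof.
move=> [p0 p1] aS; rewrite -p1 (bigD1 a)//= lerDl.
by apply: sumr_ge0 => b /andP[bS _]; exact: p0.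
Qed.

Lemma bregman_klE p q : in_simplex S p -> in_simplex S q ->
  bregman_kl S p q = \sum_(a in S) p a * (ln (p a) - ln (q a)).
Proof.
move=> [_ p1] [_ q1]; rewrite /bregman_kl /negent.
have -> : \sum_(a in S) (ln (q a) + 1) * (p a - q a) =
   \sum_(a in S) (p a * ln (q a)) - \sum_(a in S) (q a * ln (q a))
    + (\sum_(a in S) p a - \sum_(a in S) q a).
  by rewrite -!sumrB -big_split /=; apply: eq_bigr => a _; ring.
rewrite p1 q1 subrr addr0.
under [RHS]eq_bigr do rewrite mulrBr.
rewrite sumrB; ring.
Qed.

(** This is [ln t <= t - 1] at [t = y / x] with its equality case, which later identifies the
    minimiser of a local objective. For [x = 0] the logarithmic term is multiplied by 0. *)
Lemma kl_term_ge (x y : R) : 0 <= x -> 0 < y ->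
  x - y <= x * (ln x - ln y) /\ (x * (ln x - ln y) <= x - y -> x = y).
Proof.
move=> x0 y0; move: x0; rewrite le_eqVlt => /predU1P[<-|x0].
  by rewrite !mul0r sub0r; split; [rewrite oppr_le0 ltW|lra].
have E : x * (ln x - ln y) = - (x * ln (y / x)).
  by rewrite ln_div ?posrE//; ring.
have xy0 : 0 < y / x by rewrite divr_gt0.
have key : y / x != 1 -> ln (y / x) < y / x - 1.
  move=> yx; rewrite -ltr_expR lnK ?posrE//.
  have := @expR_gt1Dx R (y / x - 1); rewrite (addrC 1) subrK; apply.
  by rewrite subr_eq0.
have mx : x * (y / x) = y by rewrite mulrC divfK ?gt_eqF.
rewrite E; have [yx1|/key h] := eqVneq (y / x) 1.
  rewrite yx1 ln1 mulr0 oppr0 -mx yx1 mulr1 subrr; split => //.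
have : x * ln (y / x) < x * (y / x - 1) by rewrite ltr_pM2l.
by rewrite mulrBr mx mulr1; split; lra.
Qed.

Lemma bregman_kl_ge0 p q : in_simplex S p -> in_simplex S q ->
  (forall a, a \in S -> 0 < q a) -> 0 <= bregman_kl S p q.
Proof.
move=> sp sq q0; rewrite bregman_klE//.
apply: (@le_trans _ _ (\sum_(a in S) (p a - q a))).
  by rewrite sumrB; case: sp => _ ->; case: sq => _ ->; rewrite subrr.
apply: ler_sum => a aS; apply: (kl_term_ge _ (q0 a aS)).1.
by case: sp => + _; apply.
Qed.

(** Both masses are 1, so the termwise lower bounds [p a - q a] sum to 0; a nonpositive divergence
    then forces equality in every term. *)
Lemma bregman_kl_eq p q : in_simplex S p -> in_simplex S q ->
  (forall a, a \in S -> 0 < q a) -> bregman_kl S p q <= 0 ->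
  forall a, a \in S -> p a = q a.
Proof.
move=> sp sq q0; rewrite bregman_klE// => h a aS.
apply: (kl_term_ge _ (q0 a aS)).2; first by case: sp => + _; apply.
have p0 b : b \in S -> 0 <= p b by case: sp => + _; apply.
have := h; rewrite -[X in _ <= X](subrr 1) -{1}(proj2 sp) -(proj2 sq) -sumrB.
rewrite (bigD1 a)//= [X in _ <= X](bigD1 a)//= => h2.
rewrite -(lerD2r (\sum_(i in S | i != a) (p i - q i))); apply: le_trans h2.
rewrite lerD2l; apply: ler_sum => b /andP[bS _].
by apply: (kl_term_ge (p0 b bS) (q0 b bS)).1.
Qed.

Lemma bregman_klxx p q : (forall a, a \in S -> p a = q a) -> bregman_kl S p q = 0.
Proof.
move=> pq; rewrite /bregman_kl /negent [X in _ - X]big1 ?subr0 => [|a aS]; last first.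
  by rewrite pq// subrr mulr0.
by apply/eqP; rewrite subr_eq0; apply/eqP; apply: eq_bigr => a aS; rewrite pq.
Qed.

Lemma bregman_kl_uniform p q : in_simplex S p -> in_simplex S q ->
  (forall a, a \in S -> q a = #|S|%:R^-1) ->
  bregman_kl S p q <= ln #|S|%:R.
Proof.
move=> sp sq qE; rewrite bregman_klE//.
have p0 b : b \in S -> 0 <= p b by case: sp => + _; apply.
rewrite -[leRHS]mul1r -{1}(proj2 sp) mulr_suml; apply: ler_sum => a aS.
have S0 : 0 < #|S|%:R :> R by rewrite ltr0n card_gt0; apply/set0Pn; exists a.
rewrite ler_wpM2l ?p0// qE// lnV ?posrE// opprK gerDr.
by apply: ln_le0; exact: in_simplex_le1.
Qed.

Section Step.
Variables (eta : R) (l q : Act -> R).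
Hypotheses (eta0 : 0 < eta) (sq : in_simplex S q) (q0 : forall a, a \in S -> 0 < q a).

Let Z := \sum_(a in S) q a * expR (- (eta * l a)).
Let g a := q a * expR (- (eta * l a)) / Z.

Let Z0 : 0 < Z.
Proof.
have [a aS] : exists a, a \in S.
  apply/set0Pn/eqP => S0; case: sq => _; rewrite S0 big_set0 => /eqP.
  by rewrite eq_sym oner_eq0.
rewrite /Z (bigD1 a)//=; apply: ltr_pwDl; first by rewrite mulr_gt0 ?expR_gt0 ?q0//.
apply: sumr_ge0 => b /andP[bS _]; apply: mulr_ge0; last exact: expR_ge0.
by apply: ltW; exact: q0.
Qed.

Let g0 a : a \in S -> 0 < g a.
Proof. by move=> aS; rewrite divr_gt0// mulr_gt0 ?expR_gt0 ?q0. Qed.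

Let sg : in_simplex S g.
Proof.
split=> [a aS|]; first by rewrite ltW ?g0.
by rewrite -mulr_suml divff// gt_eqF.
Qed.

Let obj p := \sum_(a in S) l a * p a + eta^-1 * bregman_kl S p q.

(** Gibbs variational identity: up to the constant [- (eta^-1 * ln Z)], the objective is a
    divergence to the normalised exponential weights [g]. *)
Let objE p : in_simplex S p -> obj p = - (eta^-1 * ln Z) + eta^-1 * bregman_kl S p g.
Proof.
move=> sp; rewrite /obj !bregman_klE//.
have -> : \sum_(a in S) p a * (ln (p a) - ln (g a)) =
  \sum_(a in S) p a * (ln (p a) - ln (q a)) + eta * \sum_(a in S) l a * p a + ln Z.
  rewrite -[ln Z]mul1r -(proj2 sp) mulr_sumr mulr_suml -!big_split /=.
  apply: eq_bigr => a aS; rewrite /g ln_div ?posrE ?mulr_gt0 ?expR_gt0 ?q0//.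
  by rewrite lnM ?posrE ?expR_gt0 ?q0// expRK; ring.
rewrite !mulrDr mulrA mulVf ?gt_eqF//; ring.
Qed.

(** A minimiser coincides on [S] with the Gibbs weights, so the three-point relation is an equality.
    The last bound expands the normaliser [Z] to second order; [expRN_le2] holds at every
    nonnegative argument, so the estimated losses may be arbitrarily large. *)
Lemma entropic_step m : in_simplex S m -> (forall p, in_simplex S p -> obj m <= obj p) ->
  [/\ forall a, a \in S -> 0 < m a,
      forall p, in_simplex S p -> obj p = obj m + eta^-1 * bregman_kl S p m &
      (forall a, a \in S -> 0 <= l a) ->
      \sum_(a in S) l a * q a - eta / 2 * (\sum_(a in S) q a * l a ^+ 2) <= obj m].
Proof.
move=> sm mmin.
have mg : forall a, a \in S -> m a = g a.
  apply: bregman_kl_eq => //.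
  (* Minimality against [g], read through [objE], bounds the divergence of [m] from [g] by 0. *)
  have := mmin _ sg; rewrite (objE sm) (objE sg) (@bregman_klxx g g)// mulr0 addr0 gerDl.
  by rewrite pmulr_rle0 ?invr_gt0.
have objm : obj m = - (eta^-1 * ln Z) by rewrite objE// (bregman_klxx mg) mulr0 addr0.
split=> [a aS|p sp|l0]; first by rewrite mg// g0.
- rewrite objm objE//; congr (_ + _ * _); rewrite !bregman_klE//.
  by apply: eq_bigr => a aS; rewrite mg.
- rewrite objm -(mulrN _ (ln Z)).
  have Zle : Z <= 1 - eta * \sum_(a in S) l a * q a
     + eta ^+ 2 / 2 * \sum_(a in S) q a * l a ^+ 2.
    rewrite -{1}(proj2 sq) !mulr_sumr -sumrB -big_split /=; apply: ler_sum => a aS.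
    have := @expRN_le2 R (eta * l a); rewrite mulr_ge0 ?(ltW eta0) ?l0// => /(_ isT) h.
    apply: le_trans (ler_wpM2l (ltW (q0 aS)) h) _.
    by rewrite le_eqVlt; apply/orP; left; apply/eqP; ring.
  have lnZ : ln Z <= Z - 1.
    by have := @le_ln1Dx R (Z - 1); rewrite (addrC 1) subrK; apply; rewrite -[ltLHS]sub0r ltrD2r.
  rewrite ler_pdivlMl//.
  set A := \sum_(a in S) l a * q a in Zle *.
  set B := \sum_(a in S) q a * l a ^+ 2 in Zle *.
  have -> : eta * (A - eta / 2 * B) = eta * A - eta ^+ 2 / 2 * B by ring.
  lra.
Qed.

End Step.

End KL.

(** * Realization plans and complexity quantities *)

Lemma sum_disjoint_le (R : numDomainType) (I J : finType) (A : pred I)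
    (B : I -> pred J) (f : J -> R) :
  (forall j, 0 <= f j) ->
  (forall i i' j, A i -> A i' -> B i j -> B i' j -> i = i') ->
  \sum_(i | A i) \sum_(j | B i j) f j <= \sum_j f j.
Proof.
move=> f0 inj; rewrite (exchange_big_dep predT)//=; apply: ler_sum => j _.
case: (pickP [pred i | A i && B i j]) => [i /= /andP[Ai Bij]|none]; last first.
  by rewrite big_pred0 ?f0// => i; have := none i.
rewrite (big_pred1 i)// => i' /=; apply/idP/eqP => [/andP[Ai' Bij']|->]; last by rewrite Ai Bij.
exact: inj Ai' Ai Bij' Bij.
Qed.

Section GameTree.
Variables (X Act : finType) (H : nat) (depth : X -> nat)
          (acts : X -> {set Act}) (parent : X -> option (X * Act)).
Hypothesis Hgame : wf_game H depth acts parent.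

Local Notation hist := (hist depth parent).
Local Notation in_hist := (in_hist depth parent).

Lemma depth_itv x : (1 <= depth x <= H)%N.
Proof. by case: Hgame. Qed.

Lemma acts_neq0 x : exists a, a \in acts x.
Proof.
by case: Hgame => _ _ h _ _; apply/set0Pn; rewrite -card_gt0.
Qed.

Lemma parent_root x : depth x = 1%N -> parent x = None.
Proof. by case: Hgame => _ _ _ h _ /h. Qed.

Lemma depth_root x : parent x = None -> depth x = 1%N.
Proof. by case: Hgame => _ _ _ h _ /h. Qed.

Lemma depth_child x y a : parent x = Some (y, a) -> depth x = (depth y).+1.
Proof. by case: Hgame => _ _ _ _ h /h []. Qed.

Lemma parent_acts x y a : parent x = Some (y, a) -> a \in acts y.
Proof. by case: Hgame => _ _ _ _ h /h []. Qed.

Lemma hist_root x : parent x = None -> hist x = [::].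
Proof. by rewrite /hist; case: (depth x) => //= n ->. Qed.

Lemma hist_child x y a : parent x = Some (y, a) -> hist x = (y, a) :: hist y.
Proof. by move=> px; rewrite /hist (depth_child px) /= px. Qed.

Lemma tree_ind (Q : X -> Prop) :
  (forall x, parent x = None -> Q x) ->
  (forall x y a, parent x = Some (y, a) -> Q y -> Q x) -> forall x, Q x.
Proof.
move=> Q0 QS x; have [n] := ubnP (depth x); elim: n x => // n IH x.
move=> dx; case E: (parent x) => [[y a]|]; last exact: Q0.
by apply: (QS _ _ _ E); apply: IH; rewrite -ltnS -(depth_child E).
Qed.

Lemma in_hist_root x x' : parent x' = None -> in_hist x x' = (x == x').
Proof. by move=> p; rewrite /in_hist hist_root//= orbF. Qed.

Lemma in_hist_child x x' y a : parent x' = Some (y, a) ->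
  in_hist x x' = (x == x') || in_hist x y.
Proof. by move=> p; rewrite /in_hist (hist_child p) /= (eq_sym y). Qed.

Lemma in_histxx x : in_hist x x.
Proof. by rewrite /in_hist eqxx. Qed.

Lemma in_hist_ind x (Q : X -> Prop) : Q x ->
  (forall x' y b, parent x' = Some (y, b) -> in_hist x y -> Q y -> Q x') ->
  forall x', in_hist x x' -> Q x'.
Proof.
move=> Qx QS; elim/tree_ind => [x' px'|x' y b px' IH].
  by rewrite in_hist_root// => /eqP <-.
rewrite (in_hist_child _ px') => /orP[/eqP <-//|xy].
exact: QS px' xy (IH xy).
Qed.

Lemma in_hist_depth x x' : in_hist x x' -> (depth x <= depth x')%N.
Proof.
move: x'; apply: in_hist_ind => // x' y b p _ h.
by rewrite (depth_child p) (leq_trans h).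
Qed.

(** This makes the subtrees below the nodes of one depth disjoint, so that policies chosen
    separately on them can be glued. *)
Lemma in_hist_inj x1 x2 x' : in_hist x1 x' -> in_hist x2 x' -> depth x1 = depth x2 -> x1 = x2.
Proof.
elim/tree_ind: x' => [x' p|x' y b p IH].
  by rewrite !in_hist_root// => /eqP -> /eqP ->.
rewrite !(in_hist_child _ p) => /orP[/eqP ->|h1] /orP[/eqP ->|h2] // e.
- by have := in_hist_depth h2; rewrite -e (depth_child p) ltnn.
- by have := in_hist_depth h1; rewrite e (depth_child p) ltnn.
- exact: IH.
Qed.

Lemma hist_depth x : {in hist x, forall z, (depth z.1 < depth x)%N}.
Proof.
elim/tree_ind: x => [x p|x y b p IH] z; first by rewrite hist_root.
rewrite (hist_child p) inE (depth_child p) => /predU1P[->//|/IH h].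
exact: ltnW.
Qed.

Lemma hist_acts x : {in hist x, forall z, z.2 \in acts z.1}.
Proof.
elim/tree_ind: x => [x p|x y b p IH] z; first by rewrite hist_root.
by rewrite (hist_child p) inE => /predU1P[->/=|/IH//]; exact: parent_acts p.
Qed.

Lemma sum_by_depth (R : zmodType) (f : X -> R) :
  \sum_x f x = \sum_(1 <= h < H.+1) \sum_(x | depth x == h) f x.
Proof.
under [RHS]eq_bigr do rewrite big_mkcond /=.
rewrite exchange_big /=; apply: eq_bigr => x _.
rewrite (bigD1_seq (depth x)) ?iota_uniq ?mem_index_iota ?ltnS ?depth_itv//= eqxx.
by rewrite big1 ?addr0// => h /negPf; rewrite eq_sym => ->.
Qed.

(** * Realization plans and sub-flows *)

Section Plans.
Variable R : realType.
Implicit Types (m : X -> Act -> R).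

Local Notation plan := (real_plan depth parent).
Local Notation plan_a := (real_plan_a depth parent).
Local Notation plan_from := (real_plan_from depth parent).

Lemma plan_root m x : parent x = None -> plan m x = 1.
Proof. by move=> p; rewrite /real_plan hist_root// big_nil. Qed.

Lemma plan_child m x y a : parent x = Some (y, a) -> plan m x = plan_a m y a.
Proof. by move=> p; rewrite /real_plan_a /real_plan (hist_child p) big_cons mulrC. Qed.

Lemma plan_congr m m2 x : (forall y b, (depth y < depth x)%N -> m y b = m2 y b) ->
  plan m x = plan m2 x.
Proof. by move=> e; rewrite /real_plan; apply: eq_big_seq => z /hist_depth /e ->. Qed.

Lemma plan_from_self m x a : plan_from m x x a = m x a.
Proof.
rewrite /real_plan_from big_seq_cond big_pred0 ?mul1r// => z.
by apply/negP => /andP[/hist_depth]; rewrite ltnNge => /negP.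
Qed.

Lemma plan_from_child m x x' y b a' : parent x' = Some (y, b) -> in_hist x y ->
  plan_from m x x' a' = plan_from m x y b * m x' a'.
Proof.
move=> p xy; rewrite /real_plan_from (hist_child p) big_cons /= in_hist_depth//.
by rewrite (mulrC (m y b)).
Qed.

Lemma plan_a_split m x x' a' : in_hist x x' ->
  plan_a m x' a' = plan m x * plan_from m x x' a'.
Proof.
move=> h; move: x' h a'; apply: in_hist_ind => [a'|x' y b p xy IH a'].
  by rewrite plan_from_self.
by rewrite (plan_from_child _ _ p xy) mulrA -IH -(plan_child _ p).
Qed.

Lemma plan_from_congr m m2 x x' a' : (forall y c, in_hist x y -> m y c = m2 y c) ->
  in_hist x x' -> plan_from m x x' a' = plan_from m2 x x' a'.
Proof.
move=> e h; move: x' h a'; apply: in_hist_ind => [a'|x' y b p xy IH a'].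
  by rewrite !plan_from_self e ?in_histxx.
by rewrite !(plan_from_child _ _ p xy) IH e// (in_hist_child _ p) xy orbT.
Qed.

Lemma policy01 m x a : policy acts m -> a \in acts x -> 0 <= m x a <= 1.
Proof.
move=> pm ax; case: (pm x) => m0 m1; rewrite m0//= -m1 (bigD1 a)//= lerDl.
by apply: sumr_ge0 => b /andP[bx _]; exact: m0.
Qed.

Lemma plan01 m x : policy acts m -> 0 <= plan m x <= 1.
Proof.
move=> pm; apply/andP; split; rewrite /real_plan big_seq.
  by apply: prodr_ge0 => z /hist_acts /(policy01 pm) /andP[].
by apply: prodr_ile1 => z /hist_acts /(policy01 pm).
Qed.

Lemma plan_a01 m x a : policy acts m -> a \in acts x -> 0 <= plan_a m x a <= 1.
Proof.
move=> pm ax; have /andP[p0 p1] := plan01 x pm; have /andP[m0 m1] := policy01 pm ax.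
by rewrite mulr_ge0//= mulr_ile1.
Qed.

Lemma plan_from01 m x x' a : policy acts m -> a \in acts x' -> 0 <= plan_from m x x' a <= 1.
Proof.
move=> pm ax; have /andP[m0 m1] := policy01 pm ax.
have h z : (z \in hist x') && (depth x <= depth z.1)%N -> 0 <= m z.1 z.2 <= 1.
  by move=> /andP[/hist_acts /(policy01 pm)].
have p0 : 0 <= \prod_(z <- hist x' | (depth x <= depth z.1)%N) m z.1 z.2.
  by rewrite big_seq_cond; apply: prodr_ge0 => z /h /andP[].
have p1 : \prod_(z <- hist x' | (depth x <= depth z.1)%N) m z.1 z.2 <= 1.
  by rewrite big_seq_cond; apply: prodr_ile1 => z /h.
by rewrite mulr_ge0//= mulr_ile1.
Qed.

Lemma sum_plan_a m x : policy acts m -> \sum_(a in acts x) plan_a m x a = plan m x.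
Proof. by move=> pm; rewrite -mulr_sumr (proj2 (pm x)) mulr1. Qed.

Lemma plan_gt0 m x : positive_policy acts m -> 0 < plan m x.
Proof.
by case=> _ pm; rewrite /real_plan big_seq; apply: prodr_gt0 => z /hist_acts /pm.
Qed.

Lemma plan_a_gt0 m x a : positive_policy acts m -> a \in acts x -> 0 < plan_a m x a.
Proof. by move=> pm ax; rewrite mulr_gt0 ?plan_gt0//; apply: (proj2 pm). Qed.

Lemma plan_from_gt0 m x x' a : positive_policy acts m -> a \in acts x' ->
  0 < plan_from m x x' a.
Proof.
move=> [_ pm] ax; rewrite mulr_gt0 ?pm// big_seq_cond.
by apply: prodr_gt0 => z /andP[/hist_acts /pm].
Qed.

(** Reach weights of the opponent and of chance: after each choice of the min-player, mass is passed
    on to the children. Inequalities, because nodes of depth [H] have no children. *)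
Definition flow (p : X -> R) : Prop :=
  \sum_(x | parent x == None) p x <= 1 /\
  forall y a, a \in acts y -> \sum_(x | parent x == Some (y, a)) p x <= p y.

(** The plan of a child equals [plan_a] at its parent pair, so summing over children and then over
    actions bounds the mass at one depth by the mass at the previous one. *)
Lemma flow_depth m (p : X -> R) h : policy acts m -> flow p -> (1 <= h)%N ->
  \sum_(x | depth x == h) p x * plan m x <= 1.
Proof.
move=> pm [f1 fS]; elim: h => // -[|h] IH _.
  apply: le_trans f1; rewrite le_eqVlt; apply/orP; left; apply/eqP.
  apply: eq_big => [x|x /eqP /parent_root px]; last by rewrite plan_root// mulr1.
  by apply/eqP/eqP => [/parent_root|/depth_root].
apply: le_trans (IH isT).
have -> : \sum_(x | depth x == h.+2) p x * plan m x =
    \sum_(y | depth y == h.+1) \sum_(a in acts y) \sum_(x | parent x == Some (y, a)) p x * plan_a m y a.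
  rewrite pair_big_dep /= (exchange_big_dep (fun x => depth x == h.+2)) /=; last first.
    by move=> [y a] x /= /andP[/eqP dy _] /eqP /depth_child ->; rewrite dy.
  apply: eq_bigr => x /eqP dx.
  case px: (parent x) => [[y a]|]; last by have := depth_root px; rewrite dx.
  rewrite (big_pred1 (y, a)) => [|[y' a'] /=]; first by rewrite (plan_child _ px).
  have dy : depth y = h.+1 by have := depth_child px; rewrite dx => -[].
  have ay := parent_acts px.
  apply/idP/eqP => [/andP[_ /eqP[-> ->]]//|[-> ->]].
  by rewrite dy ay !eqxx.
apply: ler_sum => y _; rewrite -(sum_plan_a _ pm) mulr_sumr.
apply: ler_sum => a ay; rewrite -mulr_suml ler_wpM2r ?fS//.
by have /andP[] := plan_a01 pm ay.
Qed.

Lemma flow_sum m (p : X -> R) : policy acts m -> flow p ->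
  \sum_x \sum_(a in acts x) p x * plan_a m x a <= H%:R.
Proof.
move=> pm fp; under eq_bigr do rewrite -mulr_sumr sum_plan_a//.
rewrite sum_by_depth; apply: (@le_trans _ _ (\sum_(1 <= h < H.+1) 1)).
  rewrite big_nat_cond [leRHS]big_nat_cond; apply: ler_sum => h /andP[/andP[h1 _] _].
  exact: flow_depth.
by rewrite big_const_nat iter_addr addr0 subn1.
Qed.

(** * Complexity quantities *)

Section Kappa.
Variable ms : X -> Act -> R.
Hypothesis Hms : positive_policy acts ms.

Local Notation kap := (kappa depth acts parent ms).
Local Notation kap_at := (kappa_at depth acts parent ms).

(** Realization plans are at most 1, so the sum of the inverses of [plan_a ms] bounds the set whose
    supremum is [kap]. *)
Lemma kappa_ge m : policy acts m ->
  \sum_x \sum_(a in acts x) plan_a m x a / plan_a ms x a <= kap.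
Proof.
move=> pm; apply: ub_le_sup; last by exists m.
exists (\sum_x \sum_(a in acts x) (plan_a ms x a)^-1) => _ [m2 [pm2 ->]].
apply: ler_sum => x _; apply: ler_sum => a ax.
rewrite ler_piMl ?invr_ge0 ?(ltW (plan_a_gt0 Hms ax))//.
by have /andP[] := plan_a01 pm2 ax.
Qed.

Lemma has_sup_kappa_at x : has_sup [set s | exists mu, policy acts mu /\
        s = \sum_(x' : X | in_hist x x') \sum_(a' in acts x')
               plan_from mu x x' a' / plan_from ms x x' a'].
Proof.
split; first by eexists; exists ms; split; [exact: (proj1 Hms)|reflexivity].
exists (\sum_(x' | in_hist x x') \sum_(a in acts x') (plan_from ms x x' a)^-1) => _ [m2 [pm2 ->]].
apply: ler_sum => x' _; apply: ler_sum => a ax.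
rewrite ler_piMl ?invr_ge0 ?(ltW (plan_from_gt0 _ Hms ax))//.
by have /andP[] := plan_from01 x pm2 ax.
Qed.

Lemma kappa_at_ge m x : policy acts m ->
  \sum_(x' | in_hist x x') \sum_(a in acts x')
     plan_from m x x' a / plan_from ms x x' a <= kap_at x.
Proof.
by move=> pm; apply: ub_le_sup; [exact: (has_sup_kappa_at x).2|exists m].
Qed.

(** The sampling policy is itself a competitor, with all ratios equal to 1. The bound yields the
    positivity of [kap]. *)
Lemma kappa_ge_AX : (AX acts)%:R <= kap.
Proof.
apply: le_trans (kappa_ge (proj1 Hms)); rewrite /AX natr_sum; apply: ler_sum => x _.
rewrite -sum1_card natr_sum; apply: ler_sum => a ax.
by rewrite divff// gt_eqF// plan_a_gt0.
Qed.

Lemma kappa_at_gt0 x : 0 < kap_at x.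
Proof.
apply: lt_le_trans (kappa_at_ge x (proj1 Hms)).
have [a ax] := acts_neq0 x.
rewrite (bigD1 x) ?in_histxx//= (bigD1 a)//= -addrA.
apply: ltr_pwDl; first by rewrite divr_gt0// plan_from_gt0.
have r0 y b : b \in acts y -> 0 <= plan_from ms x y b / plan_from ms x y b.
  by move=> yb; rewrite divr_ge0// ltW// plan_from_gt0.
apply: addr_ge0; first by apply: sumr_ge0 => b /andP[bx _]; exact: r0.
by apply: sumr_ge0 => y _; apply: sumr_ge0 => b yb; exact: r0.
Qed.

(* The policy that follows [m] above depth [h] and [mf x] below the node [x] of
   depth [h] competes in the supremum [kap]. *)
Lemma kappa_depth_family m (mf : X -> X -> Act -> R) (h : nat) :
  policy acts m -> (forall x, policy acts (mf x)) ->
  \sum_(x | depth x == h) plan m x / plan ms x *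
     (\sum_(x' | in_hist x x') \sum_(a in acts x')
        plan_from (mf x) x x' a / plan_from ms x x' a) <= kap.
Proof.
move=> pm pmf.
pose mc y := if (depth y < h)%N then m y else
  if [pick x | (depth x == h) && in_hist x y] is Some x then mf x y else m y.
have pmc : policy acts mc.
  by move=> y; rewrite /mc; case: ifP => _; [|case: pickP => [x _|_]]; rewrite ?pm//; exact: pmf.
have mcE x y : depth x = h -> in_hist x y -> mc y = mf x y.
  move=> dx xy; rewrite /mc -dx ltnNge (in_hist_depth xy) /=.
  case: pickP => [x2 /andP[/eqP d2 h2]|/(_ x)]; last by rewrite eqxx xy.
  by rewrite (in_hist_inj h2 xy).
have E x : depth x == h -> plan m x / plan ms x *
     (\sum_(x' | in_hist x x') \sum_(a in acts x')
        plan_from (mf x) x x' a / plan_from ms x x' a) =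
    \sum_(x' | in_hist x x') \sum_(a in acts x') plan_a mc x' a / plan_a ms x' a.
  move=> /eqP dx; rewrite mulr_sumr; apply: eq_bigr => x' xx'.
  rewrite mulr_sumr; apply: eq_bigr => a ax'.
  rewrite !(plan_a_split _ _ xx') (@plan_congr mc m x) => [|y b dy]; last first.
    by rewrite /mc -dx dy.
  rewrite (@plan_from_congr mc (mf x))// => [|y c xy]; last by rewrite (mcE _ _ dx xy).
  by rewrite mulf_div.
rewrite (eq_bigr _ E); apply: le_trans (kappa_ge pmc).
apply: sum_disjoint_le => [x'|x1 x2 x' /eqP d1 /eqP d2 h1 h2].
  apply: sumr_ge0 => a ax; rewrite divr_ge0 ?(ltW (plan_a_gt0 Hms ax))//.
  by have /andP[] := plan_a01 pmc ax.
by apply: in_hist_inj h1 h2 _; rewrite d1 d2.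
Qed.

Lemma kappa_depth m (h : nat) : policy acts m ->
  \sum_(x | depth x == h) plan m x / plan ms x * kap_at x <= kap.
Proof.
move=> pm; apply/ler_addgt0Pr => e e0; rewrite -lerBlDr.
pose W := \sum_(x | depth x == h) plan m x / plan ms x.
have w0 x : 0 <= plan m x / plan ms x.
  by rewrite divr_ge0 ?(ltW (plan_gt0 _ Hms))//; have /andP[] := plan01 x pm.
have W0 : 0 <= W by apply: sumr_ge0.
(* Each supremum [kap_at x] is replaced by a policy within this slack of it. The weights sum to [W],
   so the total loss stays below [e]; the [+ 1] covers [W = 0]. *)
have e1 : 0 < e / (W + 1) by rewrite divr_gt0// ltr_wpDl.
have /choice[mf mfP] : forall x, exists f : X -> Act -> R, policy acts f /\
   kap_at x - e / (W + 1) < \sum_(x' | in_hist x x') \sum_(a in acts x')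
        plan_from f x x' a / plan_from ms x x' a.
  by move=> x; have [_ [f [pf ->]] lt] := sup_adherent e1 (has_sup_kappa_at x); exists f.
have := kappa_depth_family h pm (fun x => (mfP x).1).
apply: le_trans.
apply: (@le_trans _ _ (\sum_(x | depth x == h) (plan m x / plan ms x * (kap_at x - e / (W + 1))))).
  under [leRHS]eq_bigr do rewrite mulrBr.
  rewrite sumrB -mulr_suml -/W lerD2l lerN2 mulrA ler_pdivrMr ?ltr_wpDl//.
  by rewrite mulrC ler_wpM2l ?(ltW e0)// lerDl.
by apply: ler_sum => x _; rewrite ler_wpM2l// ltW//; case: (mfP x).
Qed.

Lemma kappa_sum m : policy acts m ->
  \sum_x plan m x / plan ms x * kap_at x <= H%:R * kap.
Proof.
move=> pm; rewrite sum_by_depth; apply: (@le_trans _ _ (\sum_(1 <= h < H.+1) kap)).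
  by apply: ler_sum => h _; exact: kappa_depth.
by rewrite big_const_nat iter_addr addr0 subn1 mulr_natl.
Qed.

(** * Sums along one trajectory *)

Section Path.
Variables (xs : nat -> X) (as_ : nat -> Act).
Hypothesis xsP : forall h, (1 <= h <= H)%N -> depth (xs h) = h /\ as_ h \in acts (xs h).
Hypothesis xsS : forall h, (1 <= h < H)%N -> parent (xs h.+1) = Some (xs h, as_ h).

(** A node can occur only at the step equal to its depth, so one indicator per pair records the
    whole trajectory. *)
Definition visited x a : R := ((xs (depth x) == x) && (as_ (depth x) == a))%:R.

(** Turns a sum along a random trajectory into a sum over fixed pairs weighted by indicators, whose
    conditional means the protocol prescribes. *)
Lemma path_sum (f : X -> Act -> R) :
  \sum_x \sum_(a in acts x) visited x a * f x a = \sum_(1 <= h < H.+1) f (xs h) (as_ h).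
Proof.
rewrite sum_by_depth big_nat_cond [RHS]big_nat_cond; apply: eq_bigr => h /andP[hH _].
have {hH}[dx ax] := xsP hH.
rewrite (bigD1 (xs h)) ?dx//= [X in _ + X]big1 ?addr0 => [|x /andP[/eqP dxx xne]]; last first.
  by apply: big1 => a _; rewrite /visited dxx eq_sym (negPf xne) mul0r.
rewrite (bigD1 (as_ h))//= [X in _ + X]big1 ?addr0 => [|a /andP[_ ane]]; last first.
  by rewrite /visited dx eqxx eq_sym (negPf ane) mul0r.
by rewrite /visited dx !eqxx mul1r.
Qed.

Lemma visited01 x a : 0 <= visited x a <= 1.
Proof. by rewrite /visited ler0n lern1 leq_b1. Qed.

Lemma path_sum_le (f : X -> Act -> R) : (forall x a, a \in acts x -> 0 <= f x a) ->
  \sum_(1 <= h < H.+1) f (xs h) (as_ h) <= \sum_x \sum_(a in acts x) f x a.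
Proof.
move=> f0; rewrite -path_sum; apply: ler_sum => x _; apply: ler_sum => a ax.
by rewrite ler_piMl ?f0//; have /andP[] := visited01 x a.
Qed.

Lemma path_root m : plan m (xs 1) = 1.
Proof.
have H1 : (1 <= 1 <= H)%N by case: Hgame => -> _.
by have [d1 _] := xsP H1; rewrite plan_root// parent_root.
Qed.

Lemma path_in_hist h k : (1 <= h <= k)%N -> (k <= H)%N -> in_hist (xs h) (xs k).
Proof.
move=> /andP[h1]; elim: k => [|k IH]; first by rewrite leqn0 => /eqP h0; rewrite h0 in h1.
rewrite leq_eqVlt => /predU1P[->|hk] kH; first by rewrite in_histxx.
have k1 : (1 <= k < H)%N by rewrite (leq_trans h1)//= -ltnS.
by rewrite (in_hist_child _ (xsS k1)) IH ?orbT// ltnW.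
Qed.

(** The competitor [mc] plays [as_ h] at [xs h] with probability 1 and follows [m] elsewhere. The
    terms along the path in the sum for [kap_at (xs h)] then add up to the left side. The factor
    [kap_at] in the local learning rate is there to cancel this quantity. *)
Lemma path_kappa m h : policy acts m -> (1 <= h <= H)%N ->
  (1 + \sum_(h.+1 <= k < H.+1) \prod_(h.+1 <= i < k.+1) (m (xs i) (as_ i) / ms (xs i) (as_ i)))
    / ms (xs h) (as_ h) <= kap_at (xs h).
Proof.
move=> pm hH; have [dh ah] := xsP hH; have /andP[h1 hleH] := hH.
pose mc y a := if y == xs h then (a == as_ h)%:R else m y a.
have pmc : policy acts mc.
  move=> y; rewrite /mc; case: eqP => [->|_]; last exact: pm.
  split=> [a _|]; first by rewrite ler0n.
  by rewrite (bigD1 (as_ h))//= eqxx big1 ?addr0// => a /andP[_ /negPf ->].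
have fr k : (h <= k <= H)%N ->
   plan_from mc (xs h) (xs k) (as_ k) / plan_from ms (xs h) (xs k) (as_ k) =
   (\prod_(h.+1 <= i < k.+1) (m (xs i) (as_ i) / ms (xs i) (as_ i))) / ms (xs h) (as_ h).
  elim: k => [|k IH]; first by rewrite leqn0 => /andP[/eqP h0 _]; rewrite h0 in h1.
  move=> /andP[]; rewrite leq_eqVlt => /predU1P[<- _|hk kH].
    by rewrite !plan_from_self big_geq// /mc !eqxx.
  have k1 : (1 <= k < H)%N by rewrite (leq_trans h1)//= -ltnS.
  have hin : in_hist (xs h) (xs k) by apply: path_in_hist => //; [rewrite h1|exact: ltnW].
  rewrite !(plan_from_child _ _ (xsS k1) hin) big_nat_recr //= invfM mulrACA IH; last first.
    by rewrite -ltnS hk ltnW.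
  rewrite /mc ifF; first by rewrite mulrAC.
  apply/eqP => e; have [dk _] := xsP (h := k.+1) kH.
  by move: hk; rewrite -dk e dh ltnn.
apply: le_trans (kappa_at_ge (xs h) pmc).
pose f x a := if in_hist (xs h) x then plan_from mc (xs h) x a / plan_from ms (xs h) x a else 0.
have f0 x a : a \in acts x -> 0 <= f x a.
  move=> ax; rewrite /f; case: ifP => // _.
  by rewrite divr_ge0 ?(ltW (plan_from_gt0 _ Hms ax))//; have /andP[] := plan_from01 (xs h) pmc ax.
have := path_sum_le f0; rewrite (big_cat_nat (n := h)) //=; last exact: leqW.
(* Only the terms on the path from step [h] on are kept; all others are nonnegative. *)
move=> /(le_trans _) le.
apply: le_trans (le_trans (le _ _) _).
- apply: (_ : _ <= \sum_(h <= k < H.+1) f (xs k) (as_ k)).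
  rewrite [leRHS]big_ltn// mulrDl mul1r mulr_suml.
  have -> : f (xs h) (as_ h) = (ms (xs h) (as_ h))^-1.
    by rewrite /f in_histxx fr ?leqnn// big_geq// mul1r.
  rewrite lerD2l [leLHS]big_nat_cond [leRHS]big_nat_cond; apply: ler_sum => k /andP[/andP[hk kH] _].
  by rewrite /f path_in_hist ?h1 ?(ltnW hk)// fr// (ltnW hk).
- rewrite lerDr big_nat_cond; apply: sumr_ge0 => k /andP[/andP[k1 kh] _].
  have [|_ ak] := @xsP k; first by rewrite k1 (leq_trans (ltnW kh)).
  exact: f0.
- rewrite [leRHS]big_mkcond; apply: ler_sum => x _; rewrite /f; case: ifP => // _.
  by rewrite big1.
Qed.

End Path.
End Kappa.
End Plans.
End GameTree.

(** * Bounded random variables and exponential supermartingales *)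

Section BoundedMeasurable.
Variables (R : realType) (d : measure_display) (Om : measurableType d).
Implicit Types (G : set (set Om)) (f g : Om -> R).

(** Boundedness gives integrability and is preserved by products and exponentials. Measurability
    refers to the sigma-algebra generated by [G], which is [G] itself when [G] is one. *)
Definition bmeas G f :=
  @measurable_fun _ _ (g_sigma_algebraType G) (measurableTypeR R) setT f /\
  exists M : R, forall w, `|f w| <= M.

Lemma bmeasP G f : sigma_algebra setT G -> Fmeas_real G f ->
  (exists M, forall w, `|f w| <= M) -> bmeas G f.
Proof.
move=> sG mf bf; split => // _ B mB; rewrite setTI /measurable /=.
by rewrite sigma_algebra_id//; apply: mf.
Qed.

Lemma bmeas_preimage G f (B : set R) : sigma_algebra setT G -> bmeas G f ->
  measurable B -> G (f @^-1` B).
Proof.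
move=> sG [mf _] mB; have := mf measurableT B mB.
by rewrite setTI /measurable /= sigma_algebra_id.
Qed.

Lemma bmeas_cst G c : bmeas G (fun _ => c).
Proof. by split; [exact: measurable_cst | exists `|c|]. Qed.

Lemma bmeasD G f g : bmeas G f -> bmeas G g -> bmeas G (fun w => f w + g w).
Proof.
move=> [mf [M1 b1]] [mg [M2 b2]]; split; first exact: measurable_funD.
by exists (M1 + M2) => w; rewrite (le_trans (ler_normD _ _))// lerD.
Qed.

Lemma bmeasM G f g : bmeas G f -> bmeas G g -> bmeas G (fun w => f w * g w).
Proof.
move=> [mf [M1 b1]] [mg [M2 b2]]; split; first exact: measurable_funM.
by exists (M1 * M2) => w; rewrite normrM ler_pM.
Qed.

Lemma bmeasN G f : bmeas G f -> bmeas G (fun w => - f w).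
Proof.
move=> [mf [M1 b1]]; split; first exact: measurableT_comp.
by exists M1 => w; rewrite normrN.
Qed.

Lemma bmeasB G f g : bmeas G f -> bmeas G g -> bmeas G (fun w => f w - g w).
Proof. by move=> bf bg; apply: bmeasD => //; apply: bmeasN. Qed.

Lemma bmeas_sum G (I : Type) (s : seq I) (Pr : pred I) (f : I -> Om -> R) :
  (forall i, Pr i -> bmeas G (f i)) -> bmeas G (fun w => \sum_(i <- s | Pr i) f i w).
Proof.
move=> bf; elim: s => [|i s IH].
  have -> : (fun w => \sum_(i <- [::] | Pr i) f i w) = fun=> 0.
    by apply/funext => w; rewrite big_nil.
  exact: bmeas_cst.
have -> : (fun w => \sum_(j <- i :: s | Pr j) f j w) = fun w =>
    if Pr i then f i w + \sum_(j <- s | Pr j) f j w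
    else \sum_(j <- s | Pr j) f j w by apply/funext => w; rewrite big_cons.
by case: (boolP (Pr i)) => // Pi; apply: bmeasD => //; apply: bf.
Qed.

Lemma bmeas_prod G (I : Type) (s : seq I) (Pr : pred I) (f : I -> Om -> R) :
  (forall i, Pr i -> bmeas G (f i)) -> bmeas G (fun w => \prod_(i <- s | Pr i) f i w).
Proof.
move=> bf; elim: s => [|i s IH].
  have -> : (fun w => \prod_(i <- [::] | Pr i) f i w) = fun=> 1.
    by apply/funext => w; rewrite big_nil.
  exact: bmeas_cst.
have -> : (fun w => \prod_(j <- i :: s | Pr j) f j w) = fun w =>
    if Pr i then f i w * \prod_(j <- s | Pr j) f j w
    else \prod_(j <- s | Pr j) f j w by apply/funext => w; rewrite big_cons.
by case: (boolP (Pr i)) => // Pi; apply: bmeasM => //; apply: bf.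
Qed.

Lemma bmeas_expR G f : bmeas G f -> bmeas G (fun w => expR (f w)).
Proof.
move=> [mf [M b]]; split.
  by apply: (measurableT_comp (f := @expR R)) => //; exact: measurable_expR.
exists (expR M) => w; rewrite ger0_norm ?expR_ge0// ler_expR.
by apply: le_trans (b w); apply: ler_norm.
Qed.

Lemma bmeas_indic G (A : set Om) : sigma_algebra setT G -> G A ->
  bmeas G (\1_A : Om -> R).
Proof.
move=> sG GA; split.
  apply: (@measurable_indic _ (g_sigma_algebraType G)).
  by rewrite /measurable /= sigma_algebra_id.
by exists 1 => w; rewrite indicE; case: (_ \in _); rewrite ?normr1 ?normr0.
Qed.

Lemma bmeas_sub G G' f : G `<=` G' -> bmeas G f -> bmeas G' f.
Proof.
move=> GG' [mf bf]; split => // _ B mB; have := mf measurableT B mB.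
by rewrite /measurable /=; apply: sub_sigma_algebra2.
Qed.

End BoundedMeasurable.

(** * Expectations tested against a sub-sigma-algebra *)

Section Expectation.
Variables (R : realType) (d : measure_display) (Om : measurableType d)
  (P : probability Om R).
Implicit Types (f g : Om -> R) (G : set (set Om)).

Notation bmeasT := (@bmeas R d Om measurable).
Notation Ex f := (Rintegral P setT f).

Lemma sigma_algebra_measurableT : sigma_algebra setT (@measurable d Om).
Proof. exact: sigma_algebra_measurable. Qed.

Lemma bmeas_measurable_fun f : bmeasT f -> measurable_fun setT f.
Proof.
by move=> bf _ B mB; rewrite setTI; apply: bmeas_preimage bf mB;
  exact: sigma_algebra_measurableT.
Qed.

Lemma bmeas_integrable f : bmeasT f -> P.-integrable setT (EFin \o f).
Proof.
move=> bf; have mf := bmeas_measurable_fun bf; case: bf => _ [M b].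
apply: (@measurable_bounded_integrable _ _ _ P) => //.
  by rewrite (le_lt_trans (probability_le1 P measurableT))// ltry.
exists M; split; first exact: num_real.
by move=> x Mx w _ /=; rewrite (le_trans (b w))// ltW.
Qed.

Lemma Ex_cst c : Ex (fun _ => c) = c.
Proof. by rewrite Rintegral_cst//= probability_setT mulr1. Qed.

Lemma ExD f g : bmeasT f -> bmeasT g -> Ex (fun w => f w + g w) = Ex f + Ex g.
Proof. by move=> bf bg; rewrite RintegralD//; exact: bmeas_integrable. Qed.

Lemma ExZ c f : bmeasT f -> Ex (fun w => c * f w) = c * Ex f.
Proof. by move=> bf; rewrite RintegralZl//; exact: bmeas_integrable. Qed.

Lemma ExB f g : bmeasT f -> bmeasT g -> Ex (fun w => f w - g w) = Ex f - Ex g.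
Proof. by move=> bf bg; rewrite RintegralB//; exact: bmeas_integrable. Qed.

Lemma le_Ex f g : bmeasT f -> bmeasT g -> (forall w, f w <= g w) -> Ex f <= Ex g.
Proof. by move=> bf bg fg; apply: le_Rintegral => //; exact: bmeas_integrable. Qed.

Lemma Ex_ge0 f : (forall w, 0 <= f w) -> 0 <= Ex f.
Proof. by move=> f0; apply: Rintegral_ge0 => w _. Qed.

Lemma Ex_sum (I : Type) (s : seq I) (Pr : pred I) (f : I -> Om -> R) :
  (forall i, Pr i -> bmeasT (f i)) ->
  Ex (fun w => \sum_(i <- s | Pr i) f i w) = \sum_(i <- s | Pr i) Ex (f i).
Proof.
move=> bf; elim: s => [|i s IH].
  by rewrite big_nil -[RHS](Ex_cst 0); congr Rintegral; apply/funext => w; rewrite big_nil.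
rewrite big_cons; under eq_Rintegral do rewrite big_cons.
case: ifPn => // Pi; rewrite ExD ?IH//; first exact: bf.
exact: bmeas_sum.
Qed.

Lemma Ex_indic (A : set Om) f : measurable A -> bmeasT f ->
  (\int[P]_(w in A) (f w)%:E = (Ex (fun w => \1_A w * f w))%:E)%E.
Proof.
move=> mA bf; have bAf : bmeasT (fun w => \1_A w * f w).
  by apply: bmeasM => //; apply: bmeas_indic => //; exact: sigma_algebra_measurableT.
rewrite /Rintegral fineK; last exact: integrable_fin_num (bmeas_integrable bAf).
rewrite [LHS]integral_mkcond; apply: eq_integral => w _ /=.
by rewrite patchE indicE; case: ifP => _; rewrite ?mul1r ?mul0r.
Qed.

Lemma Ex_prob (A : set Om) : measurable A -> P A = (Ex (\1_A))%:E.
Proof.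
move=> mA; rewrite /Rintegral integral_indic// setIT fineK//.
by rewrite fin_num_measure.
Qed.

Lemma Ex_eq0 f : bmeasT f -> (forall w, 0 <= f w) -> Ex f <= 0 ->
  P [set w | 0 < f w] = 0%E.
Proof.
move=> bf f0 Ef; have Ef0 : Ex f = 0.
  by apply/eqP; rewrite eq_le Ef Ex_ge0.
have mf := bmeas_measurable_fun bf.
have mfE : measurable_fun setT (EFin \o f) by exact/measurable_EFinP.
have intf0 : (\int[P]_w (`|(EFin \o f) w|) = 0)%E.
  rewrite (_ : (fun w => _) = EFin \o f); last first.
    by apply/funext => w /=; rewrite ger0_norm.
  by rewrite -[LHS]fineK ?(integrable_fin_num _ (bmeas_integrable bf))//; congr EFin.
have /= [N [mN PN sN]] := (ae_eq_integral_abs P measurableT mfE).1 intf0.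
apply: (subset_measure0 (B := N)) => //.
  rewrite (_ : [set w | 0 < f w] = f @^-1` `]0, +oo[).
    by rewrite -[_ @^-1` _]setTI; apply: mf => //; exact: measurable_itv.
  by apply/funext => w /=; rewrite in_itv/= andbT.
move=> w /= fw; apply: sN => /= /(_ I) [] fw0.
by rewrite fw0 ltxx in fw.
Qed.

Lemma Ex_markov f c : bmeasT f -> (forall w, 0 <= f w) -> 0 < c -> Ex f <= 1 ->
  (P [set w | (c <= f w)%R] <= (c^-1)%:E)%E.
Proof.
move=> bf f0 c0 Ef1; have mA : measurable [set w | c <= f w].
  rewrite (_ : [set w | c <= f w] = f @^-1` `[c, +oo[).
    rewrite -[_ @^-1` _]setTI; apply: (bmeas_measurable_fun bf) => //.
  by apply/funext => w /=; rewrite in_itv/= andbT.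
have bA : bmeasT \1_[set w | c <= f w].
  by apply: bmeas_indic => //; exact: sigma_algebra_measurableT.
rewrite Ex_prob// lee_fin -[leRHS]mulr1 (le_trans _ (ler_wpM2l _ Ef1)) ?invr_ge0 ?(ltW c0)//.
rewrite -ExZ//; apply: le_Ex => //; first exact: bmeasM (bmeas_cst _ _) bf.
move=> w; rewrite indicE; case: (boolP (w \in _)) => [|_].
  by rewrite inE /= => cfw; rewrite mulrC ler_pdivlMr// mul1r.
by rewrite mulr_ge0 ?invr_ge0 ?(ltW c0).
Qed.

(** [g] is approximated uniformly by step functions with level sets in [G], against which [D]
    integrates to 0. As [D] is bounded, a uniform error in [g] gives a proportional error in the
    integral. *)
Lemma Ex_orthogonal G (D g : Om -> R) : sigma_algebra setT G -> G `<=` measurable ->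
  bmeasT D -> (forall A, G A -> Ex (fun w => \1_A w * D w) = 0) ->
  bmeas G g -> Ex (fun w => g w * D w) = 0.
Proof.
move=> sG GM bD D0 bg.
(* Adding the bound [M] to [g] leaves the integral unchanged, since [Ex D = 0] by the case
   [A = setT]. *)
wlog g0 : g bg / forall w, 0 <= g w => [hyp|].
  have [_ [M bM]] := bg.
  have /hyp : bmeas G (fun w => g w + M) by apply: bmeasD => //; exact: bmeas_cst.
  have bgT := bmeas_sub GM bg.
  have -> : (fun w => (g w + M) * D w) = (fun w => g w * D w + M * D w).
    by apply/funext => w; rewrite mulrDl.
  rewrite ExD ?ExZ//; [|exact: bmeasM|exact: bmeasM (bmeas_cst _ _) bD].
  have -> : Ex D = 0.
    have GT : G setT by case: sG => s0 sC _; rewrite -(setD0 setT); apply: sC.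
    rewrite -(D0 _ GT); congr Rintegral; apply/funext => w.
    by rewrite indicE mem_set// mul1r.
  rewrite mulr0 addr0; apply => w.
  by rewrite -lerBlDr sub0r; have := bM w; rewrite ler_norml => /andP[].
have bgT := bmeas_sub GM bg.
have [_ [K bK]] := bg; have [_ [M bM]] := bD.
pose A (N k : nat) := [set w | Num.truncn (N.+1%:R * g w) = k].
have GA N k : G (A N k).
  rewrite (_ : A N k = (fun w => N.+1%:R * g w) @^-1` `[k%:R, k.+1%:R[).
    by apply: bmeas_preimage => //; apply: bmeasM => //; exact: bmeas_cst.
  apply/seteqP; split => w; rewrite /A /= in_itv /=.
    by move=> <-; apply: truncn_itv; rewrite mulr_ge0.
  by move=> /truncn_def.
(* [g] rounded down to a multiple of [1 / N.+1]; the bound [K] on [g] makes the sum finite. *)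
pose gN (N : nat) w : R := \sum_(k < (Num.truncn (N.+1%:R * K)).+1) (k%:R / N.+1%:R) * \1_(A N k) w.
have gNE N w : gN N w = (Num.truncn (N.+1%:R * g w))%:R / N.+1%:R.
  have lk : (Num.truncn (N.+1%:R * g w) < (Num.truncn (N.+1%:R * K)).+1)%N.
    rewrite ltnS; apply: le_truncn; rewrite ler_wpM2l//.
    by apply: le_trans (bK w); exact: ler_norm.
  rewrite /gN (bigD1 (Ordinal lk))//= indicE mem_set//= mulr1 big1 ?addr0// => k /eqP kne.
  rewrite indicE memNset ?mulr0// => /= Ak; apply: kne; apply/val_inj => /=.
  by rewrite Ak.
have bgN N : bmeasT (gN N).
  apply: bmeas_sum => k _; apply: bmeasM; first exact: bmeas_cst.
  by apply: bmeas_indic; [exact: sigma_algebra_measurableT|apply/GM/GA].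
have gN0 N : Ex (fun w => gN N w * D w) = 0.
  have -> : (fun w => gN N w * D w) = (fun w => \sum_(k < (Num.truncn (N.+1%:R * K)).+1)
       (k%:R / N.+1%:R) * (\1_(A N k) w * D w)).
    by apply/funext => w; rewrite mulr_suml; apply: eq_bigr => k _; rewrite mulrA.
  have b1 k : bmeasT (fun w => \1_(A N k) w * D w).
    apply: bmeasM => //; apply: bmeas_indic; first exact: sigma_algebra_measurableT.
    exact/GM/GA.
  rewrite Ex_sum => [|k _]; last by apply: bmeasM => //; exact: bmeas_cst.
  by rewrite big1// => k _; rewrite ExZ// D0 ?mulr0.
have bnd N : `|Ex (fun w => g w * D w)| <= M / N.+1%:R.
  rewrite -[X in `|X|]subr0 -(gN0 N) -ExB; [|exact: bmeasM|exact: bmeasM].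
  have diff w : `|g w * D w - gN N w * D w| <= M / N.+1%:R.
    rewrite -mulrBl normrM mulrC ler_pM// gNE.
    have := truncn_itv (mulr_ge0 (ler0n R N.+1) (g0 w)).
    move=> /andP[h1 h2].
    have N0 : 0 < N.+1%:R :> R by [].
    have p1 : (Num.truncn (N.+1%:R * g w))%:R / N.+1%:R <= g w.
      by rewrite ler_pdivrMr// (mulrC (g w)).
    rewrite ger0_norm ?subr_ge0// lerBlDl -[X in _ + X]mul1r -mulrDl natr1 ler_pdivlMr// (mulrC (g w)); exact: ltW.
  have bdif : bmeasT (fun w => g w * D w - gN N w * D w).
    by apply: bmeasB; apply: bmeasM.
  have hi : Ex (fun w => g w * D w - gN N w * D w) <= M / N.+1%:R.
    rewrite -[leRHS]Ex_cst; apply: le_Ex => //; first exact: bmeas_cst.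
    by move=> w; have := diff w; rewrite ler_norml => /andP[].
  have lo : - (M / N.+1%:R) <= Ex (fun w => g w * D w - gN N w * D w).
    rewrite -[leLHS]Ex_cst; apply: le_Ex => //; first exact: bmeas_cst.
    by move=> w; have := diff w; rewrite ler_norml => /andP[].
  by rewrite ler_norml lo hi.
apply/eqP; rewrite -normr_le0 leNgt; apply/negP => e0.
set e := `|_| in e0 bnd.
(* This index [N] satisfies [M / e < N.+1], so the error bound is smaller than [e]. *)
have := bnd (Num.truncn (M / e)); rewrite leNgt => /negP; apply.
rewrite ltr_pdivrMr// mulrC -ltr_pdivrMr//.
exact: truncnS_gt.
Qed.

(** The integrated form of equal conditional expectations given [G]: agreement on the sets of [G]
    extends to bounded [G]-measurable weights. *)
Lemma Ex_condE G (f1 f2 g : Om -> R) : sigma_algebra setT G -> G `<=` measurable ->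
  bmeasT f1 -> bmeasT f2 ->
  (forall A, G A -> Ex (fun w => \1_A w * f1 w) = Ex (fun w => \1_A w * f2 w)) ->
  bmeas G g -> Ex (fun w => g w * f1 w) = Ex (fun w => g w * f2 w).
Proof.
move=> sG GM b1 b2 f12 bg; have bgT := bmeas_sub GM bg.
apply/eqP; rewrite -subr_eq0 -ExB; [|exact: bmeasM|exact: bmeasM].
under eq_Rintegral do rewrite -mulrBr.
apply/eqP/(Ex_orthogonal sG GM) => //; first exact: bmeasB.
move=> A GA; under eq_Rintegral do rewrite mulrBr.
have bA : bmeasT \1_A.
  by apply: bmeas_indic; [exact: sigma_algebra_measurableT|exact: GM].
rewrite ExB; [|exact: bmeasM|exact: bmeasM].
by rewrite f12// subrr.
Qed.

Lemma filtration_le (F : nat -> set (set Om)) m n : filtration F -> (m <= n)%N -> F m `<=` F n.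
Proof.
move=> HF /subnK <-; elim: (n - m)%N => [//|k IH]; rewrite addSn.
by apply: subset_trans IH _; case: (HF (k + m)%N).
Qed.

(* The indicators of [Fl t] are multiplied into the supermartingale, so the
   exponential inequality is only required on [Fl t]. *)
Lemma exp_supermartingale (F : nat -> set (set Om)) (T : nat) (U C : nat -> Om -> R)
    (Fl : nat -> set Om) (i : R) : filtration F ->
  (forall t, (1 <= t <= T)%N -> bmeas (F t) (U t)) ->
  (forall t, (1 <= t <= T)%N -> bmeas (F t.-1) (C t)) ->
  (forall t, (1 <= t <= T)%N -> F t.-1 (Fl t)) ->
  (forall t g, (1 <= t <= T)%N -> bmeas (F t.-1) g -> (forall w, 0 <= g w) ->
     (forall w, ~ Fl t w -> g w = 0) ->
     Ex (fun w => g w * expR (U t w)) <= Ex (fun w => g w * expR (C t w))) ->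
  exists B, [/\ measurable B, (P B <= (expR (- i))%:E)%E &
    forall w, ~ B w -> (forall t, (1 <= t <= T)%N -> Fl t w) ->
      \sum_(1 <= t < T.+1) (U t w - C t w) <= i].
Proof.
move=> HF bU bC FFl HE.
pose M n w := \prod_(1 <= t < n.+1) (\1_(Fl t) w * expR (U t w - C t w)).
have FM t : F t `<=` measurable by case: (HF t).
have sF t : sigma_algebra setT (F t) by case: (HF t).
have bM n : (n <= T)%N -> bmeas (F n) (M n).
  move=> nT; rewrite /M.
  have -> : (fun w => \prod_(1 <= t < n.+1) (\1_(Fl t) w * expR (U t w - C t w))) =
     (fun w => \prod_(1 <= t < n.+1 | (1 <= t < n.+1)%N && true) (\1_(Fl t) w * expR (U t w - C t w))).
    by apply/funext => w; rewrite big_nat_cond.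
  apply: bmeas_prod => t /andP[/andP[t1 tn] _].
  have tT : (1 <= t <= T)%N by rewrite t1 (leq_trans _ nT).
  have ptn : (t.-1 <= n)%N by rewrite (leq_trans (leq_pred _)).
  apply: bmeasM.
    by apply: bmeas_indic => //; apply: filtration_le (FFl _ tT).
  apply: bmeas_expR; apply: bmeasB.
    by apply: bmeas_sub (bU _ tT); apply: filtration_le.
  by apply: bmeas_sub (bC _ tT); apply: filtration_le.
have M0 n w : 0 <= M n w by apply: prodr_ge0 => t _; rewrite mulr_ge0 ?expR_ge0// indicE.
have EM n : (n <= T)%N -> Ex (M n) <= 1.
  elim: n => [|n IH] nT.
    rewrite -[leRHS]Ex_cst; apply: le_Ex => [||w]; [exact: bmeas_sub (bM _ _)|exact: bmeas_cst|].
    by rewrite /M big_nil.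
  apply: le_trans (IH (ltnW nT)).
  have tT : (1 <= n.+1 <= T)%N by [].
  have bMn := bM n (ltnW nT).
  (* With this weight, known at time [n], the hypothesis on round [n.+1] reads
     [Ex (M n.+1) <= Ex (M n * \1_(Fl n.+1))]. *)
  pose g w := M n w * \1_(Fl n.+1) w * expR (- C n.+1 w).
  have bind : bmeas (F n) (\1_(Fl n.+1) : Om -> R) by apply: bmeas_indic => //; exact: FFl tT.
  have bg : bmeas (F n) g.
    apply: bmeasM; first exact: bmeasM.
    by apply: bmeas_expR; apply: bmeasN; exact: bC tT.
  have g0 w : 0 <= g w by rewrite /g !mulr_ge0 ?expR_ge0// indicE.
  have gFl w : ~ Fl n.+1 w -> g w = 0 by move=> nF; rewrite /g indicE memNset// mulr0 mul0r.
  have := HE _ _ tT bg g0 gFl.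
  have -> : (fun w => g w * expR (U n.+1 w)) = M n.+1.
    apply/funext => w; rewrite [RHS]big_nat_recr//= -/(M n w) /g -!mulrA -expRD.
    by rewrite (addrC (- _)).
  move=> /le_trans; apply; apply: le_Ex.
  - apply: bmeasM; first exact: bmeas_sub (FM n) bg.
    by apply: bmeas_expR; exact: bmeas_sub (FM n) (bC _ tT).
  - exact: bmeas_sub (FM n) bMn.
  - move=> w; rewrite /g -!mulrA -expRD addNr expR0 mulr1 ler_piMr//.
(* Markov's inequality at level [expR i]; on the intersection of the [Fl t], [M T] is the
   exponential of the sum to be bounded. *)
exists [set w | expR i <= M T w]; split.
- have := bmeas_preimage (sF T) (bM T (leqnn _)) (measurable_itv `[expR i, +oo[).
  by move=> /FM; congr measurable; apply/funext => w /=; rewrite in_itv/= andbT.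
- by rewrite expRN; apply: Ex_markov; [exact: bmeas_sub (bM _ _)|exact: M0|exact: expR_gt0|exact: EM].
- move=> w /= /negP; rewrite -ltNge => MT FlT.
  rewrite -ler_expR expR_sum; apply: ltW; apply: le_lt_trans MT.
  rewrite /M big_nat_cond [leRHS]big_nat_cond le_eqVlt; apply/orP; left; apply/eqP.
  apply: eq_bigr => t /andP[/andP[t1 tn] _].
  by rewrite indicE mem_set ?mul1r//; apply: FlT; rewrite t1.
Qed.

End Expectation.

(** * The regret along one trajectory *)

(** The identity at [h] is multiplied by the product of the earlier [rho] and summed. It is applied
    to the learner and to the comparator with the same [q], so that [q 1] cancels in the
    difference. *)
Lemma path_telescope (R : comPzRingType) (H : nat) (rho l q g : nat -> R) :
  q H.+1 = 0 ->
  (forall h, (1 <= h <= H)%N -> rho h * (l h + q h.+1) = q h + g h) ->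
  \sum_(1 <= h < H.+1) (\prod_(1 <= i < h.+1) rho i) * l h =
  q 1%N + \sum_(1 <= h < H.+1) (\prod_(1 <= i < h) rho i) * g h.
Proof.
move=> qH step.
suff claim n : (n <= H)%N ->
   \sum_(1 <= h < n.+1) (\prod_(1 <= i < h.+1) rho i) * l h
     + (\prod_(1 <= i < n.+1) rho i) * q n.+1 =
   q 1%N + \sum_(1 <= h < n.+1) (\prod_(1 <= i < h) rho i) * g h.
  by rewrite -(claim H)// qH mulr0 addr0.
elim: n => [|n IH] nH.
  by rewrite !big_geq// mul1r add0r addr0.
rewrite big_nat_recr//= [in RHS]big_nat_recr//= addrA -(IH (ltnW nH)).
rewrite -!addrA; congr (_ + _).
rewrite -mulrDr [X in X * (l _ + _)]big_nat_recr//= -mulrA step ?nH//.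
by rewrite mulrDr.
Qed.

Section Round.
Variables (X Act : finType) (H : nat) (depth : X -> nat)
          (acts : X -> {set Act}) (parent : X -> option (X * Act)).
Hypothesis Hgame : wf_game H depth acts parent.
Variables (R : realType) (ms : X -> Act -> R).
Hypothesis Hms : positive_policy acts ms.
Variables (xs : nat -> X) (as_ : nat -> Act).
Hypothesis xsP : forall h, (1 <= h <= H)%N -> depth (xs h) = h /\ as_ h \in acts (xs h).
Hypothesis xsS : forall h, (1 <= h < H)%N -> parent (xs h.+1) = Some (xs h, as_ h).

Local Notation plan := (real_plan depth parent).
Local Notation plan_a := (real_plan_a depth parent).
Local Notation kap_at := (kappa_at depth acts parent ms).

Lemma path_plan (m : X -> Act -> R) h : (1 <= h <= H)%N ->
  plan m (xs h) / plan ms (xs h) =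
  \prod_(1 <= i < h) (m (xs i) (as_ i) / ms (xs i) (as_ i)).
Proof.
elim: h => // -[|h] IH hH.
  by rewrite big_geq// !(path_root Hgame xsP) divr1.
have h1 : (1 <= h.+1 < H)%N by case/andP: hH.
rewrite !(plan_child Hgame _ (xsS h1)) big_nat_recr//= -IH; last by case/andP: h1 => _ /ltnW.
by rewrite mulf_div.
Qed.

Lemma path_plan_a (m : X -> Act -> R) h : (1 <= h <= H)%N ->
  plan_a m (xs h) (as_ h) / plan_a ms (xs h) (as_ h) =
  \prod_(1 <= i < h.+1) (m (xs i) (as_ i) / ms (xs i) (as_ i)).
Proof.
move=> hH; rewrite big_nat_recr /=; last by case/andP: hH.
by rewrite -path_plan// mulf_div.
Qed.

Lemma path_sumX (f : X -> R) : (forall x, x != xs (depth x) -> f x = 0) ->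
  \sum_x f x = \sum_(1 <= h < H.+1) f (xs h).
Proof.
move=> f0; rewrite (sum_by_depth Hgame) big_nat_cond [RHS]big_nat_cond.
apply: eq_bigr => h /andP[hH _]; have [dx _] := xsP hH.
rewrite (bigD1 (xs h)) ?dx//= big1 ?addr0// => x /andP[/eqP dxx xne].
by rewrite f0// dxx.
Qed.

Variables (eta : R) (ls q : nat -> R) (mu mu' : X -> Act -> R).
Hypothesis eta0 : 0 < eta.
Hypothesis Hmu : positive_policy acts mu.
Hypothesis Hls : forall h, (1 <= h <= H)%N -> 0 <= ls h <= 1.
Hypothesis qH : q H.+1 = 0.

Let lt h := loss_est ms (xs h) (as_ h) (ls h) (q h.+1).
Let obj h p := \sum_(a in acts (xs h)) lt h a * p a
  + (eta / kap_at (xs h))^-1 * bregman_kl (acts (xs h)) p (mu (xs h)).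

Hypothesis Hstep : forall h, (1 <= h <= H)%N ->
  [/\ in_simplex (acts (xs h)) (mu' (xs h)),
      forall p, in_simplex (acts (xs h)) p -> obj h (mu' (xs h)) <= obj h p &
      q h = obj h (mu' (xs h))].
Hypothesis Hstay : forall x, x != xs (depth x) -> forall a, a \in acts x -> mu' x a = mu x a.

Let etah h := eta / kap_at (xs h).
Let etah0 h : 0 < etah h.
Proof. by rewrite divr_gt0// (kappa_at_gt0 Hgame Hms). Qed.

Let inner_lt h (p : Act -> R) : (1 <= h <= H)%N ->
  \sum_(a in acts (xs h)) lt h a * p a = p (as_ h) / ms (xs h) (as_ h) * (ls h + q h.+1).
Proof.
move=> hH; have [_ ah] := xsP hH.
rewrite (bigD1 (as_ h))//= big1 ?addr0 => [|a /andP[_ /negPf ane]]; last first.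
  by rewrite /lt /loss_est ane mul0r.
by rewrite /lt /loss_est eqxx; ring.
Qed.

Let q_ge0 h : (1 <= h <= H.+1)%N -> 0 <= q h.
Proof.
move=> /andP[h1]; have [k] := ubnP (H.+1 - h); elim: k h h1 => // k IH h h1.
move=> kh; rewrite leq_eqVlt => /predU1P[->|hH]; first by rewrite qH.
have hH' : (1 <= h <= H)%N by rewrite h1.
have [sm _ ->] := Hstep hH'; have [_ ah] := xsP hH'.
have qS : 0 <= q h.+1.
  by apply: IH => //; rewrite subSS -ltnS (leq_trans _ kh)// ltnS subSn.
apply: addr_ge0.
  rewrite inner_lt//; apply: mulr_ge0.
    apply: divr_ge0; first exact: (proj1 sm).
    by apply: ltW; apply: (proj2 Hms).
  by rewrite addr_ge0//; have /andP[] := Hls hH'.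
apply: mulr_ge0; first by rewrite invr_ge0 ltW// etah0.
by apply: bregman_kl_ge0 => //; [exact: (proj1 Hmu)|move=> a; exact: (proj2 Hmu)].
Qed.

Let lt_ge0 h a : (1 <= h <= H)%N -> 0 <= lt h a.
Proof.
move=> hH; have [_ ah] := xsP hH; rewrite /lt /loss_est; case: ifP => // _.
apply: divr_ge0; last by apply: ltW; apply: (proj2 Hms).
rewrite addr_ge0//; first by have /andP[] := Hls hH.
by apply: q_ge0; case/andP: hH.
Qed.

Let step h : (1 <= h <= H)%N ->
  [/\ forall a, a \in acts (xs h) -> 0 < mu' (xs h) a,
      forall p, in_simplex (acts (xs h)) p ->
         obj h p = q h + (etah h)^-1 * bregman_kl (acts (xs h)) p (mu' (xs h)) &
      \sum_(a in acts (xs h)) lt h a * mu (xs h) a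
        - etah h / 2 * (\sum_(a in acts (xs h)) mu (xs h) a * lt h a ^+ 2) <= q h].
Proof.
move=> hH; have [sm mmin qE] := Hstep hH.
have [|p1 p2 p3] := @entropic_step R Act (acts (xs h)) (etah h) (lt h) (mu (xs h)) (etah0 h)
   (proj1 Hmu (xs h)) _ (mu' (xs h)) sm mmin.
  by move=> a; exact: (proj2 Hmu).
split=> //; first by move=> p sp; rewrite qE; exact: p2.
by rewrite qE; apply: p3 => a _; exact: lt_ge0.
Qed.

Lemma round_positive : policy acts mu' -> positive_policy acts mu'.
Proof.
move=> pm; split => // x a ax.
have [xv|xv] := eqVneq x (xs (depth x)); last by rewrite Hstay//; exact: (proj2 Hmu).
have [p1 _ _] := step (depth_itv Hgame x).
by rewrite -xv in p1; exact: p1.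
Qed.

Let rho h := mu (xs h) (as_ h) / ms (xs h) (as_ h).
(** The sum of importance ratios along the trajectory, restarted with weight 1 just before step [h];
    [V 1] is Z^t. *)
Let V h := \sum_(h <= k < H.+1) \prod_(h <= i < k.+1) rho i.

Let rho0 h : (1 <= h <= H)%N -> 0 <= rho h.
Proof.
by move=> hH; have [_ ah] := xsP hH; rewrite divr_ge0 ?(ltW (proj2 Hms _ _ ah)) ?(ltW (proj2 Hmu _ _ ah)).
Qed.

Let VS h : (1 <= h <= H)%N -> V h = rho h * (1 + V h.+1).
Proof.
move=> /andP[h1 hH]; rewrite /V big_ltn// big_nat1 mulrDr mulr1; congr (_ + _).
rewrite mulr_sumr big_nat_cond [RHS]big_nat_cond; apply: eq_bigr => k /andP[/andP[hk _] _].
by rewrite big_ltn// leqW// ltnW.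
Qed.

(** Testing the minimum at the current policy, where the divergence vanishes, gives
    [q h <= rho h * (ls h + q h.+1)], which is dominated by the recursion [VS]. *)
Let qV h : (1 <= h <= H.+1)%N -> q h <= V h.
Proof.
move=> /andP[h1]; have [k] := ubnP (H.+1 - h); elim: k h h1 => // k IH h h1.
move=> kh; rewrite leq_eqVlt => /predU1P[->|hH]; first by rewrite qH /V big_geq.
have hH' : (1 <= h <= H)%N by rewrite h1.
have [_ mmin ->] := Hstep hH'.
apply: le_trans (mmin _ (proj1 Hmu _)) _.
rewrite /obj (@bregman_klxx _ _ _ (mu (xs h)))// mulr0 addr0 inner_lt// VS//.
rewrite ler_wpM2l ?rho0// lerD//; first by have /andP[] := Hls hH'.
by apply: IH => //; rewrite subSS -ltnS (leq_trans _ kh)// ltnS subSn.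
Qed.

Let gap h := \sum_(a in acts (xs h)) lt h a * mu (xs h) a - q h.

(** The second-order error contains [ls h + q h.+1] twice. One factor, with [rho h], is at most
    [V h]; the other, divided by the sampling probability, is at most [kap_at (xs h)] by
    [path_kappa], and the learning rate cancels it. *)
Let gapV h : (1 <= h <= H)%N -> gap h <= eta / 2 * V h.
Proof.
move=> hH; have [_ _ s3] := step hH; have [_ ah] := xsP hH.
have /andP[h1 hleH] := hH.
apply: (@le_trans _ _ (etah h / 2 * (\sum_(a in acts (xs h)) mu (xs h) a * lt h a ^+ 2))).
  by rewrite lerBlDr addrC -lerBlDr.
have -> : \sum_(a in acts (xs h)) mu (xs h) a * lt h a ^+ 2 =
   rho h * (ls h + q h.+1) * ((ls h + q h.+1) / ms (xs h) (as_ h)).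
  rewrite (bigD1 (as_ h))//= big1 ?addr0 => [|a /andP[_ /negPf ane]]; last first.
    by rewrite /lt /loss_est ane expr0n mulr0.
  by rewrite /lt /loss_est eqxx /rho; ring.
have ms0 : 0 < ms (xs h) (as_ h) by apply: (proj2 Hms).
have lq0 : 0 <= ls h + q h.+1.
  by rewrite addr_ge0 ?q_ge0//; have /andP[] := Hls hH.
have lq : ls h + q h.+1 <= 1 + V h.+1.
  by rewrite lerD ?qV//; have /andP[] := Hls hH.
have pk : (ls h + q h.+1) / ms (xs h) (as_ h) <= kap_at (xs h).
  apply: le_trans (path_kappa Hgame Hms xsP xsS (proj1 Hmu) hH).
  by rewrite ler_wpM2r// invr_ge0 ltW.
have k0 := kappa_at_gt0 Hgame Hms (xs h).
rewrite /etah (_ : eta / kap_at (xs h) / 2 = eta / 2 / kap_at (xs h)); last by ring.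
rewrite -mulrA ler_wpM2l ?divr_ge0 ?(ltW eta0)// ler_pdivrMl// (mulrC (kap_at _)).
apply: ler_pM => //; [by rewrite mulr_ge0 ?rho0|by rewrite divr_ge0// ltW|].
by rewrite VS// ler_wpM2l ?rho0.
Qed.

Lemma round_bound (md : X -> Act -> R) : policy acts md ->
  \sum_(1 <= h < H.+1) plan_a mu (xs h) (as_ h) / plan_a ms (xs h) (as_ h) * ls h
  - \sum_(1 <= h < H.+1) plan_a md (xs h) (as_ h) / plan_a ms (xs h) (as_ h) * ls h
  <= eta / 2 * H%:R * (\sum_(1 <= h < H.+1) plan_a mu (xs h) (as_ h) / plan_a ms (xs h) (as_ h))
   + \sum_x plan md x / plan ms x * (kap_at x / eta *
       (bregman_kl (acts x) (md x) (mu x) - bregman_kl (acts x) (md x) (mu' x))).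
Proof.
move=> pmd.
have E (m : X -> Act -> R) (f : nat -> R) :
   \sum_(1 <= h < H.+1) plan_a m (xs h) (as_ h) / plan_a ms (xs h) (as_ h) * f h =
   \sum_(1 <= h < H.+1) (\prod_(1 <= i < h.+1) (m (xs i) (as_ i) / ms (xs i) (as_ i))) * f h.
  rewrite big_nat_cond [RHS]big_nat_cond; apply: eq_bigr => h /andP[hH _].
  by rewrite path_plan_a.
rewrite !E (@path_telescope _ _ rho ls q gap)//; last first.
  by move=> h hH; rewrite /gap inner_lt// -/(rho h); ring.
pose gd h := (etah h)^-1 * (bregman_kl (acts (xs h)) (md (xs h)) (mu' (xs h))
  - bregman_kl (acts (xs h)) (md (xs h)) (mu (xs h))).
rewrite (@path_telescope _ _ _ ls q gd)//; last first.
  move=> h hH; have [_ s2 _] := step hH.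
  have := s2 _ (pmd (xs h)); rewrite /obj inner_lt// => s2h.
  rewrite /gd mulrBr addrA -s2h; rewrite -/(etah h); ring.
rewrite opprD addrACA subrr add0r; apply: lerD.
  have EZ : \sum_(1 <= h < H.+1) plan_a mu (xs h) (as_ h) / plan_a ms (xs h) (as_ h) =
     \sum_(1 <= h < H.+1) \prod_(1 <= i < h.+1) rho i.
    have := E mu (fun=> 1); under eq_bigr do rewrite mulr1.
    by move=> ->; under eq_bigr do rewrite mulr1.
  rewrite EZ; set Z := (X in _ <= _ * X).
  have prod0 j k : (1 <= j)%N -> (k <= H)%N -> 0 <= \prod_(j <= i < k.+1) rho i.
    move=> j1 kH; rewrite big_nat_cond; apply: prodr_ge0 => i /andP[/andP[ji ik] _].
    by apply: rho0; rewrite (leq_trans j1)//= -ltnS (leq_trans ik).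
  (* Each of the [H] steps costs at most [eta / 2 * Z], because the prefix product times [V h] is
     the tail of [Z] from [h] on. *)
  have -> : eta / 2 * H%:R * Z = \sum_(1 <= h < H.+1) (eta / 2 * Z).
    by rewrite big_const_nat iter_addr addr0 subn1 /= -[RHS]mulr_natr; ring.
  rewrite big_nat_cond [leRHS]big_nat_cond; apply: ler_sum => h /andP[hH _].
  have /andP[h1 hle] := hH.
  have W0 : 0 <= \prod_(1 <= i < h) rho i.
    by case: h h1 hle {hH} => // h _ hle; apply: prod0 => //; exact: ltnW.
  apply: le_trans (ler_wpM2l W0 (gapV hH)) _.
  rewrite mulrCA ler_wpM2l ?divr_ge0 ?(ltW eta0)//.
  rewrite /V mulr_sumr /Z [leRHS](big_cat_nat (n := h))//= 1?leqW//.
  apply: ler_wpDl.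
    rewrite big_nat_cond; apply: sumr_ge0 => k /andP[/andP[k1 kh] _].
    by apply: prod0 => //; rewrite (leq_trans (ltnW kh)).
  rewrite le_eqVlt; apply/orP; left; apply/eqP.
  rewrite big_nat_cond [RHS]big_nat_cond; apply: eq_bigr => k /andP[/andP[hk _] _].
  by rewrite [RHS](big_cat_nat (n := h))//= ltnW.
(* Off the trajectory the policy is unchanged and the divergences cancel. Extending the sum to all
   of [X], with weights independent of the path, is what permits telescoping over rounds. *)
rewrite (@path_sumX (fun x => _)) => [|x xv]; last first.
  rewrite (_ : bregman_kl (acts x) (md x) (mu' x) = bregman_kl (acts x) (md x) (mu x)).
    by rewrite subrr !mulr0.
  have e a : a \in acts x -> mu' x a = mu x a by exact: Hstay.
  rewrite /bregman_kl; congr (_ - _ - _).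
    by apply: eq_bigr => a ax; rewrite e.
  by apply: eq_bigr => a ax; rewrite e.
rewrite -sumrN le_eqVlt; apply/orP; left; apply/eqP.
rewrite big_nat_cond [RHS]big_nat_cond; apply: eq_bigr => h /andP[hH _].
rewrite path_plan// /gd /etah invf_div -mulrN; congr (_ * _); ring.
Qed.

End Round.

(** * The learning protocol *)

Lemma union_bound (R : realType) (d : measure_display) (Om : measurableType d)
    (P : probability Om R) (I : eqType) (s : seq I) (Q : I -> Om -> Prop) (e : I -> R) :
  (forall i, i \in s -> exists B, [/\ measurable B, (P B <= (e i)%:E)%E &
     forall w, ~ B w -> Q i w]) ->
  exists B, [/\ measurable B, (P B <= (\sum_(i <- s) e i)%:E)%E &
     forall w, ~ B w -> forall i, i \in s -> Q i w].
Proof.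
elim: s => [|i s IH] h.
  by exists set0; split => //; rewrite big_nil measure0.
have [|B1 [m1 e1 q1]] := IH; first by move=> j js; apply: h; rewrite inE js orbT.
have [|B2 [m2 e2 q2]] := h i; first by rewrite inE eqxx.
exists (B2 `|` B1); split; first exact: measurableU.
  rewrite big_cons EFinD; apply: le_trans (measureU2 _ _ _) _ => //; exact: leeD.
move=> w nB j; rewrite inE => /predU1P[->|js]; first by apply: q2 => ?; apply: nB; left.
by apply: q1 => // ?; apply: nB; right.
Qed.

(** * Conditional means in one episode and the sub-flow property *)

Section Episode.
Variables (X Act : finType) (H : nat) (depth : X -> nat)
          (acts : X -> {set Act}) (parent : X -> option (X * Act)).
Hypothesis Hgame : wf_game H depth acts parent.
Variables (R : realType) (ms : X -> Act -> R).
Hypothesis Hms : positive_policy acts ms.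
Variables (T : nat) (d : measure_display) (Om : measurableType d) (P : probability Om R)
  (F : nat -> set (set Om)).
Hypothesis HF : filtration F.
Variables (V : Type) (pV : V -> X -> R) (lV : V -> X -> Act -> R).
Hypothesis HpV : forall v x, 0 <= pV v x <= 1.
Hypothesis HlV : forall v x a, 0 <= lV v x a <= 1.
Variables (nu : nat -> Om -> V)
  (xs : nat -> nat -> Om -> X) (as_ : nat -> nat -> Om -> Act)
  (ls : nat -> nat -> Om -> R).
Hypothesis Hproto : protocol H depth acts parent P F T pV lV nu ms xs as_ ls.

Local Notation plan := (real_plan depth parent).
Local Notation plan_a := (real_plan_a depth parent).
Local Notation Ex f := (Rintegral P setT f).
Local Notation bmeasT := (@bmeas R d Om measurable).
Local Notation ind t x a w := (visited depth R (fun h => xs t h w) (fun h => as_ t h w) x a).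
Local Notation p t x w := (pV (nu t w) x).
Local Notation l t x a w := (lV (nu t w) x a).
Local Notation loss t x w := (ls t (depth x) w).

Lemma F_sigma t : sigma_algebra setT (F t). Proof. by case: (HF t). Qed.
Lemma F_measurable t : F t `<=` measurable. Proof. by case: (HF t). Qed.

Section Round.
Variable t : nat.
Hypothesis tT : (1 <= t <= T)%N.
Local Notation G := (F t.-1).

Lemma episode_path w h : (1 <= h <= H)%N ->
  depth (xs t h w) = h /\ as_ t h w \in acts (xs t h w).
Proof.
by move=> hH; have [_ _ /(_ h hH) [/(_ w) [dx [ax _]] _ _ _ _]] := Hproto tT.
Qed.

Lemma episode_child w h : (1 <= h < H)%N ->
  parent (xs t h.+1 w) = Some (xs t h w, as_ t h w).
Proof.
move=> /andP[h1 hH]; have [_ _ /(_ h)] := Hproto tT.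
by rewrite h1 ltnW// => /(_ isT) [_ /(_ w hH)].
Qed.

Lemma episode_loss w h : (1 <= h <= H)%N -> 0 <= ls t h w <= 1.
Proof.
by move=> hH; have [_ _ /(_ h hH) [/(_ w) [_ []]]] := Hproto tT.
Qed.

Lemma bmeas_p x : bmeas G (fun w => p t x w).
Proof.
have [h _ _] := Hproto tT; apply: bmeasP (F_sigma _) (h x) _.
by exists 1 => w; have /andP[p0 p1] := HpV (nu t w) x; rewrite ger0_norm.
Qed.

Lemma bmeas_l x a : bmeas G (fun w => l t x a w).
Proof.
have [_ h _] := Hproto tT; apply: bmeasP (F_sigma _) (h x a) _.
by exists 1 => w; have /andP[p0 p1] := HlV (nu t w) x a; rewrite ger0_norm.
Qed.

Lemma bmeas_loss x : bmeas (F t) (fun w => loss t x w).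
Proof.
have [_ _ /(_ _ (depth_itv Hgame x)) [_ _ [_ _ h] _ _]] := Hproto tT.
apply: bmeasP (F_sigma _) h _.
by exists 1 => w; have /andP[p0 p1] := episode_loss w (depth_itv Hgame x); rewrite ger0_norm.
Qed.

Lemma F_visited x a : F t [set w | xs t (depth x) w = x /\ as_ t (depth x) w = a].
Proof.
have [_ _ /(_ _ (depth_itv Hgame x)) [_ _ [hx ha _] _ _]] := Hproto tT.
have [s0 sC sU] := F_sigma t.
have FC A : F t A -> F t (~` A) by move=> /sC; rewrite setTD.
rewrite -[X in F t X]setCK; apply: (FC _).
rewrite (_ : ~` _ = \bigcup_i (if i is 0%N then ~` [set w | xs t (depth x) w = x]
  else ~` [set w | as_ t (depth x) w = a])).
  by apply: sU => -[|i]; apply: (FC _); [exact: hx|exact: ha].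
apply/seteqP; split => w /=.
  move=> /not_andP[n|n]; [by exists 0%N|by exists 1%N].
by move=> [[|i] _ n] [e1 e2]; apply: n.
Qed.

Lemma visitedE x a w :
  ind t x a w = \1_[set w | xs t (depth x) w = x /\ as_ t (depth x) w = a] w.
Proof.
rewrite indicE /visited; congr (_%:R); congr nat_of_bool.
apply/idP/idP; rewrite inE /=; first by move=> /andP[/eqP -> /eqP ->].
by move=> [-> ->]; rewrite !eqxx.
Qed.

Lemma bmeas_visited x a : bmeas (F t) (fun w => ind t x a w).
Proof.
under eq_fun do rewrite visitedE.
by apply: bmeas_indic; [exact: F_sigma|exact: F_visited].
Qed.

Lemma Ex_visited x a g : a \in acts x -> bmeas G g ->
  Ex (fun w => g w * ind t x a w) = Ex (fun w => g w * (p t x w * plan_a ms x a)).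
Proof.
move=> ax; have bv := bmeas_sub (@F_measurable t) (bmeas_visited x a).
have bp : bmeasT (fun w => p t x w * plan_a ms x a).
  by apply: bmeasM (bmeas_cst _ _); apply: bmeas_sub (bmeas_p x); exact: F_measurable.
apply: Ex_condE => //; [exact: F_sigma|exact: F_measurable|move=> B GB].
have [_ _ /(_ _ (depth_itv Hgame x)) [_ _ _ _ /(_ B x a GB erefl ax) [h _]]] := Hproto tT.
have mB := @F_measurable t.-1 _ GB; have mS := @F_measurable t _ (F_visited x a).
apply: EFin_inj; rewrite -[RHS]Ex_indic// -h Ex_prob; last exact: measurableI.
by congr (EFin _); congr Rintegral; apply/funext => w; rewrite visitedE indicI.
Qed.

Lemma Ex_visited_loss x a g : a \in acts x -> bmeas G g ->
  Ex (fun w => g w * (ind t x a w * loss t x w)) =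
  Ex (fun w => g w * (p t x w * plan_a ms x a * l t x a w)).
Proof.
move=> ax; have bv := bmeas_sub (@F_measurable t) (bmeas_visited x a).
have bl := bmeas_sub (@F_measurable t) (bmeas_loss x).
have bp : bmeasT (fun w => p t x w * plan_a ms x a * l t x a w).
  apply: bmeasM; last by apply: bmeas_sub (bmeas_l x a); exact: F_measurable.
  by apply: bmeasM (bmeas_cst _ _); apply: bmeas_sub (bmeas_p x); exact: F_measurable.
apply: Ex_condE => //; [exact: F_sigma|exact: F_measurable|exact: bmeasM|move=> B GB].
have [_ _ /(_ _ (depth_itv Hgame x)) [_ _ _ _ /(_ B x a GB erefl ax) [_ h]]] := Hproto tT.
have mB := @F_measurable t.-1 _ GB; have mS := @F_measurable t _ (F_visited x a).
apply: EFin_inj; rewrite -[RHS]Ex_indic// -h Ex_indic//; last exact: measurableI.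
congr (EFin _); congr Rintegral; apply/funext => w; rewrite mulrA; congr (_ * _).
by rewrite visitedE indicI.
Qed.

(** Test weights are absorbed into the predictable coefficients [al] and [be], so this single
    equality of means carries the conditional information. *)
Lemma Ex_linear (al be : X -> Act -> Om -> R) :
  (forall x a, a \in acts x -> bmeas G (al x a)) ->
  (forall x a, a \in acts x -> bmeas G (be x a)) ->
  Ex (fun w => \sum_x \sum_(a in acts x)
       (al x a w * ind t x a w + be x a w * (ind t x a w * loss t x w))) =
  Ex (fun w => \sum_x \sum_(a in acts x)
       (al x a w * (p t x w * plan_a ms x a) + be x a w * (p t x w * plan_a ms x a * l t x a w))).
Proof.
move=> bal bbe.
have FM s := @F_measurable s.
have bv x a := bmeas_sub (FM t) (bmeas_visited x a).
have bl x := bmeas_sub (FM t) (bmeas_loss x).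
have bp x := bmeas_sub (FM t.-1) (bmeas_p x).
have bll x a := bmeas_sub (FM t.-1) (bmeas_l x a).
have ba x a ax := bmeas_sub (FM t.-1) (bal x a ax).
have bb x a ax := bmeas_sub (FM t.-1) (bbe x a ax).
have b1 x a : a \in acts x -> bmeasT (fun w => al x a w * ind t x a w).
  by move=> ax; apply: bmeasM (ba _ _ ax) (bv _ _).
have b2 x a : a \in acts x -> bmeasT (fun w => be x a w * (ind t x a w * loss t x w)).
  by move=> ax; apply: bmeasM (bb _ _ ax) _; apply: bmeasM.
have b3 x a : a \in acts x -> bmeasT (fun w => al x a w * (p t x w * plan_a ms x a)).
  by move=> ax; apply: bmeasM (ba _ _ ax) _; apply: bmeasM (bmeas_cst _ _).
have b4 x a : a \in acts x -> bmeasT (fun w => be x a w * (p t x w * plan_a ms x a * l t x a w)).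
  move=> ax; apply: bmeasM (bb _ _ ax) _; apply: bmeasM (bll _ _).
  by apply: bmeasM (bmeas_cst _ _).
rewrite !Ex_sum => [|x _|x _]; last 2 first.
- by apply: bmeas_sum => a ax; apply: bmeasD; [exact: b3|exact: b4].
- by apply: bmeas_sum => a ax; apply: bmeasD; [exact: b1|exact: b2].
apply: eq_bigr => x _; rewrite !Ex_sum => [|a ax|a ax]; last 2 first.
- by apply: bmeasD; [exact: b3|exact: b4].
- by apply: bmeasD; [exact: b1|exact: b2].
apply: eq_bigr => a ax; rewrite ExD; [|exact: b1|exact: b2].
rewrite [RHS]ExD; [|exact: b3|exact: b4].
by rewrite Ex_visited ?Ex_visited_loss//; [exact: bbe|exact: bal].
Qed.

Lemma Ex_linear_visited (al : X -> Act -> Om -> R) :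
  (forall x a, a \in acts x -> bmeas G (al x a)) ->
  Ex (fun w => \sum_x \sum_(a in acts x) al x a w * ind t x a w) =
  Ex (fun w => \sum_x \sum_(a in acts x) al x a w * (p t x w * plan_a ms x a)).
Proof.
move=> bal; have := @Ex_linear al (fun _ _ _ => 0) bal (fun _ _ _ => bmeas_cst _ _).
move=> h; etransitivity; last (etransitivity; first exact: h);
  by congr Rintegral; apply/funext => w; apply: eq_bigr => x _;
    apply: eq_bigr => a _; rewrite mul0r addr0.
Qed.

(** The positive part of [D] is [D] tested against the indicator of [0 < D], a set of [G]. *)
Lemma Ex_max0_le0 (D : Om -> R) : bmeas G D ->
  (forall g, bmeas G g -> (forall w, 0 <= g w) -> Ex (fun w => g w * D w) <= 0) ->
  bmeas G (fun w => Num.max 0 (D w)) /\ Ex (fun w => Num.max 0 (D w)) <= 0.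
Proof.
move=> bD hD; have GD : G [set w | 0 < D w].
  have := bmeas_preimage (F_sigma _) bD (measurable_itv `]0, +oo[).
  by congr F; apply/funext => w /=; rewrite in_itv/= andbT.
have bg : bmeas G (\1_[set w | 0 < D w] : Om -> R) by apply: bmeas_indic => //; exact: F_sigma.
have E : (fun w => Num.max 0 (D w)) = (fun w => \1_[set w | 0 < D w] w * D w).
  apply/funext => w; rewrite indicE; case: (ltP 0 (D w)) => h.
    by rewrite mem_set// mul1r.
  by rewrite memNset ?mul0r//= ltNge h.
by rewrite E; split; [exact: bmeasM|apply: hD => // w; rewrite indicE].
Qed.

(** Positive values of [deficit_root] and [deficit] are violations of the two inequalities of
    [flow]. *)
Let deficit_root w := \sum_(x | parent x == None) p t x w - 1.
Let deficit y a w := \sum_(x | parent x == Some (y, a)) p t x w - p t y w.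

Lemma visits_root w :
  \sum_x \sum_(a in acts x) (parent x == None)%:R * ind t x a w <= 1 :> R.
Proof.
have H1 : (0 < H)%N by case: Hgame.
under eq_bigr do under eq_bigr do rewrite mulrC.
rewrite (path_sum Hgame (episode_path w)) big_ltn ?ltnS// big_nat_cond big1 ?addr0.
  by rewrite lern1 leq_b1.
move=> h /andP[/andP[h2 hH] _]; case: eqP => // /(depth_root Hgame).
have hH1 : (1 <= h <= H)%N by rewrite (ltnW h2).
by have [-> _] := episode_path w hH1; move=> e; rewrite e in h2.
Qed.

(** All children of (y,a) have depth one more than [y], so at most one is visited, and only after
    (y,a). *)
Lemma visits_child y a w :
  \sum_x \sum_(b in acts x) (parent x == Some (y, a))%:R * ind t x b w <= ind t y a w.
Proof.
under eq_bigr do under eq_bigr do rewrite mulrC.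
rewrite (path_sum Hgame (episode_path w)).
have hS h : (1 <= h < H.+1)%N -> parent (xs t h w) = Some (y, a) ->
    h = (depth y).+1 /\ ind t y a w = 1.
  move=> hH ph; have [dh _] := episode_path w hH.
  have hy := depth_child Hgame ph; rewrite dh in hy; split=> //.
  have : (1 <= depth y < H)%N by have /andP[-> _] := depth_itv Hgame y; rewrite -hy; case/andP: hH.
  move/(episode_child w); rewrite -hy ph => -[e1 e2].
  by rewrite /visited -e1 -e2 !eqxx.
have [[h0 /andP[h0H /eqP ph0]]|none] := pselect (exists h, (1 <= h < H.+1)%N && (parent (xs t h w) == Some (y, a))).
  have [e0 ->] := hS _ h0H ph0.
  rewrite (bigD1_seq h0) ?iota_uniq ?mem_index_iota//= ph0 eqxx big_nat_cond big1 ?addr0//.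
  move=> h /andP[hH hne]; case: eqP => // ph; have [e _] := hS _ hH ph.
  by rewrite e e0 eqxx in hne.
rewrite big_nat_cond big1 => [|h /andP[hH _]]; first by rewrite /visited ler0n.
by case: eqP => // ph; case: none; exists h; rewrite hH ph eqxx.
Qed.

Lemma root_deficit g : bmeas G g -> (forall w, 0 <= g w) ->
  Ex (fun w => g w * deficit_root w) <= 0.
Proof.
move=> bg g0; pose al (x : X) (a : Act) w : R := g w * (parent x == None)%:R.
have bal x a : a \in acts x -> bmeas G (al x a).
  by move=> _; apply: bmeasM => //; exact: bmeas_cst.
have FM s := @F_measurable s.
have bgT := bmeas_sub (FM t.-1) bg.
have := Ex_linear_visited bal => E.
have bpl x a : bmeasT (fun w => p t x w * plan_a ms x a).
  by apply: bmeasM (bmeas_cst _ _); exact: bmeas_sub (FM _) (bmeas_p x).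
have -> : (fun w => g w * deficit_root w) =
   (fun w => (\sum_x \sum_(a in acts x) al x a w * (p t x w * plan_a ms x a)) - g w).
  apply/funext => w; rewrite /deficit_root mulrBr mulr1; congr (_ - _).
  rewrite mulr_sumr big_mkcond /=; apply: eq_bigr => x _.
  under eq_bigr do rewrite /al mulrA.
  rewrite -mulr_sumr (sum_plan_a _ _ _ (proj1 Hms)).
  case: eqP => [px|_]; last by rewrite !(mulr0, mul0r).
  by rewrite (plan_root _ _ px) /= !mulr1.
rewrite ExB//; last first.
  apply: bmeas_sum => x _; apply: bmeas_sum => a ax; apply: bmeasM => //.
  exact: bmeas_sub (FM t.-1) (bal x a ax).
rewrite -E subr_le0; apply: le_Ex => // [|w].
  apply: bmeas_sum => x _; apply: bmeas_sum => a ax; apply: bmeasM.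
    exact: bmeas_sub (FM t.-1) (bal x a ax).
  exact: bmeas_sub (FM t) (bmeas_visited x a).
rewrite -[leRHS]mulr1; apply: le_trans (ler_wpM2l (g0 w) (visits_root w)).
rewrite le_eqVlt; apply/orP; left; apply/eqP; rewrite mulr_sumr; apply: eq_bigr => x _.
by rewrite mulr_sumr; apply: eq_bigr => a _; rewrite /al mulrA.
Qed.

(** Scaled by [plan_a ms y b], the deficit is the conditional mean of the visits to children of
    (y,b) minus the visit to (y,b), nonpositive on every trajectory. Positivity of [ms] allows the
    scale to be removed. *)
Lemma child_deficit y b g : b \in acts y -> bmeas G g -> (forall w, 0 <= g w) ->
  Ex (fun w => g w * deficit y b w) <= 0.
Proof.
move=> yb bg g0; pose al (x : X) (a : Act) w : R :=
  g w * ((parent x == Some (y, b))%:R - ((x == y) && (a == b))%:R).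
have bal x a : a \in acts x -> bmeas G (al x a).
  by move=> _; apply: bmeasM => //; exact: bmeas_cst.
have FM s := @F_measurable s.
have bgT := bmeas_sub (FM t.-1) bg.
have bpT x := bmeas_sub (FM t.-1) (bmeas_p x).
have := Ex_linear_visited bal => E.
have c0 : 0 < plan_a ms y b by exact: (plan_a_gt0 Hgame Hms yb).
have sel (f : X -> Act -> R) :
   \sum_x \sum_(a in acts x) ((x == y) && (a == b))%:R * f x a = f y b.
  rewrite (bigD1 y)//= [X in _ + X]big1 ?addr0 => [|x /negPf xy]; last first.
    by apply: big1 => a _; rewrite xy mul0r.
  rewrite (bigD1 b)//= [X in _ + X]big1 ?addr0 => [|a /andP[_ /negPf ab]]; last first.
    by rewrite ab andbF mul0r.
  by rewrite !eqxx mul1r.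
rewrite -(pmulr_rle0 _ c0) -ExZ; last first.
  by apply: bmeasM => //; apply: bmeasB => //; apply: bmeas_sum => x _.
have -> : (fun w => plan_a ms y b * (g w * deficit y b w)) =
   (fun w => (\sum_x \sum_(a in acts x) al x a w * (p t x w * plan_a ms x a))).
  apply/funext => w; rewrite /deficit.
  transitivity (g w * (\sum_x \sum_(a in acts x) (parent x == Some (y, b))%:R * (p t x w * plan_a ms x a)
      - \sum_x \sum_(a in acts x) ((x == y) && (a == b))%:R * (p t x w * plan_a ms x a))).
    rewrite (sel (fun x a => p t x w * plan_a ms x a)).
    rewrite (_ : \sum_x _ = (\sum_(x | parent x == Some (y, b)) p t x w) * plan_a ms y b); first by ring.
    rewrite mulr_suml [RHS]big_mkcond /=; apply: eq_bigr => x _.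
    rewrite -mulr_sumr -mulr_sumr (sum_plan_a _ _ _ (proj1 Hms)).
    case: eqP => [px|_]; last by rewrite mul0r.
    by rewrite mul1r (plan_child Hgame _ px).
  rewrite -sumrB mulr_sumr; apply: eq_bigr => x _.
  by rewrite -sumrB mulr_sumr; apply: eq_bigr => a _; rewrite /al -mulrA mulrBl.
rewrite -E -[leRHS](Ex_cst P 0); apply: le_Ex; [|exact: bmeas_cst|move=> w].
  apply: bmeas_sum => x _; apply: bmeas_sum => a ax; apply: bmeasM.
    exact: bmeas_sub (FM t.-1) (bal x a ax).
  exact: bmeas_sub (FM t) (bmeas_visited x a).
rewrite (_ : \sum_x _ = g w * (\sum_x \sum_(a in acts x) (parent x == Some (y, b))%:R * ind t x a w - ind t y b w)).
  by rewrite mulr_ge0_le0// subr_le0 visits_child.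
rewrite -(sel (fun x a => ind t x a w)) -sumrB mulr_sumr; apply: eq_bigr => x _.
by rewrite -sumrB mulr_sumr; apply: eq_bigr => a _; rewrite /al -mulrA mulrBl.
Qed.

Definition flow_set := [set w | flow acts parent (fun x => p t x w)].

(** The positive parts of all violations add up to a nonnegative variable with nonpositive mean,
    which therefore vanishes almost surely. *)
Lemma flow_setP : G flow_set /\ P (~` flow_set) = 0%E.
Proof.
pose f w := Num.max 0 (deficit_root w) +
  \sum_y \sum_(a in acts y) Num.max 0 (deficit y a w).
have FM s := @F_measurable s.
have bdr : bmeas G deficit_root.
  by apply: bmeasB (bmeas_cst _ _); apply: bmeas_sum => x _; exact: bmeas_p.
have bd y a : bmeas G (deficit y a).
  by apply: bmeasB; [apply: bmeas_sum => x _|]; exact: bmeas_p.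
have [br er] := Ex_max0_le0 bdr root_deficit.
have bc y a ay := Ex_max0_le0 (bd y a) (fun g => @child_deficit y a g ay).
have bf : bmeas G f.
  apply: bmeasD => //; apply: bmeas_sum => y _; apply: bmeas_sum => a ay.
  exact: (bc y a ay).1.
have f0 w : 0 <= f w.
  apply: addr_ge0; first by rewrite le_max lexx.
  by apply: sumr_ge0 => y _; apply: sumr_ge0 => a _; rewrite le_max lexx.
have Ef : Ex f <= 0.
  have brT := bmeas_sub (FM t.-1) br.
  have bcT y a ay := bmeas_sub (FM t.-1) (bc y a ay).1.
  rewrite /f ExD//; last by apply: bmeas_sum => y _; apply: bmeas_sum => a; exact: bcT.
  rewrite -[leRHS]addr0 lerD// Ex_sum => [|y _]; last by apply: bmeas_sum => a; exact: bcT.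
  apply: sumr_le0 => y _; rewrite Ex_sum => [|a]; last exact: bcT.
  by apply: sumr_le0 => a ay; exact: (bc y a ay).2.
have flowE : ~` flow_set = [set w | 0 < f w].
  apply/seteqP; split => w; rewrite /flow_set /=; last first.
    move=> fw [fr fc]; move: fw; rewrite ltNge => /negP; apply.
    rewrite /f (_ : Num.max 0 _ = 0) ?add0r; last by apply/max_idPl; rewrite subr_le0.
    apply: sumr_le0 => y _; apply: sumr_le0 => a ay.
    by rewrite ge_max lexx /= subr_le0 fc.
  move=> nf; rewrite lt_def f0 andbT; apply: contra_not_neq nf => fw0.
  have r0 : 0 <= Num.max 0 (deficit_root w) by rewrite le_max lexx.
  have y0 y : true -> 0 <= \sum_(a in acts y) Num.max 0 (deficit y a w).
    by move=> _; apply: sumr_ge0 => a _; rewrite le_max lexx.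
  have c0 : 0 <= \sum_y \sum_(a in acts y) Num.max 0 (deficit y a w) by apply: sumr_ge0.
  move: fw0; rewrite /f => /eqP; rewrite paddr_eq0// => /andP[/eqP /max_idPl].
  rewrite subr_le0 => h1; rewrite psumr_eq0// => /allP h2; split=> // y a ay.
  have := h2 y; rewrite mem_index_enum => /(_ isT) /=; rewrite psumr_eq0; last first.
    by move=> b _; rewrite le_max lexx.
  move/allP => /(_ a); rewrite mem_index_enum => /(_ isT); rewrite ay /= => /eqP /max_idPl.
  by rewrite subr_le0.
split; last by rewrite flowE; apply: Ex_eq0 => //; exact: bmeas_sub (FM _) bf.
rewrite -[flow_set]setCK flowE.
have := bmeas_preimage (F_sigma _) bf (measurable_itv `]-oo, 0]).
by congr F; apply/seteqP; split => w /=; rewrite in_itv/= leNgt => /negP.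
Qed.

(** The affine majorant of [expR U] is replaced by its conditional mean, then [1 + C <= expR C]
    closes the bound. The mean is controlled by [C] on [flow_set] only; elsewhere [g] vanishes. *)
Lemma exp_step (al be : X -> Act -> Om -> R) (U C g : Om -> R) :
  (forall x a, a \in acts x -> bmeas G (al x a)) ->
  (forall x a, a \in acts x -> bmeas G (be x a)) ->
  bmeas (F t) U -> bmeas G C ->
  (forall w, expR (U w) <= 1 + \sum_x \sum_(a in acts x)
       (al x a w * ind t x a w + be x a w * (ind t x a w * loss t x w))) ->
  (forall w, flow_set w -> \sum_x \sum_(a in acts x)
       (al x a w * (p t x w * plan_a ms x a) + be x a w * (p t x w * plan_a ms x a * l t x a w))
       <= C w) ->
  bmeas G g -> (forall w, 0 <= g w) -> (forall w, ~ flow_set w -> g w = 0) ->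
  Ex (fun w => g w * expR (U w)) <= Ex (fun w => g w * expR (C w)).
Proof.
move=> bal bbe bU bC hU hC bg g0 gF.
have FM s := @F_measurable s.
have bgT := bmeas_sub (FM t.-1) bg.
have bgal x a : a \in acts x -> bmeas G (fun w => g w * al x a w).
  by move=> ax; apply: bmeasM => //; exact: bal.
have bgbe x a : a \in acts x -> bmeas G (fun w => g w * be x a w).
  by move=> ax; apply: bmeasM => //; exact: bbe.
have E := Ex_linear bgal bgbe.
pose S1 w := \sum_x \sum_(a in acts x)
       (g w * al x a w * ind t x a w + g w * be x a w * (ind t x a w * loss t x w)).
pose S2 w := \sum_x \sum_(a in acts x) (g w * al x a w * (p t x w * plan_a ms x a)
     + g w * be x a w * (p t x w * plan_a ms x a * l t x a w)).
have bS1 : bmeasT S1.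
  apply: bmeas_sum => x _; apply: bmeas_sum => a ax; apply: bmeasD; apply: bmeasM.
  - exact: bmeas_sub (FM _) (bgal x a ax).
  - exact: bmeas_sub (FM t) (bmeas_visited x a).
  - exact: bmeas_sub (FM _) (bgbe x a ax).
  - apply: bmeasM; first exact: bmeas_sub (FM t) (bmeas_visited x a).
    exact: bmeas_sub (FM t) (bmeas_loss x).
have bS2 : bmeasT S2.
  apply: (bmeas_sub (FM t.-1)).
  apply: bmeas_sum => x _; apply: bmeas_sum => a ax; apply: bmeasD; apply: bmeasM.
  - exact: bgal.
  - by apply: bmeasM (bmeas_p x) (bmeas_cst _ _).
  - exact: bgbe.
  - by apply: bmeasM (bmeas_l x a); apply: bmeasM (bmeas_p x) (bmeas_cst _ _).
apply: (@le_trans _ _ (Ex (fun w => g w + S1 w))).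
  apply: le_Ex.
  - by apply: bmeasM bgT _; apply: bmeas_expR; exact: bmeas_sub (FM _) bU.
  - exact: bmeasD.
  - move=> w; apply: le_trans (ler_wpM2l (g0 w) (hU w)) _.
    rewrite mulrDr mulr1 lerD2l mulr_sumr; apply: ler_sum => x _.
    rewrite mulr_sumr; apply: ler_sum => a _.
    by rewrite mulrDr !mulrA.
rewrite ExD// E -ExD//; apply: le_Ex.
- exact: bmeasD.
- by apply: bmeasM bgT _; apply: bmeas_expR; exact: bmeas_sub (FM _) bC.
move=> w; have [fw|nfw] := pselect (flow_set w); last first.
  rewrite gF// mul0r add0r /S2 big1// => x _; rewrite big1// => a _.
  by rewrite !mul0r addr0.
apply: (@le_trans _ _ (g w * (1 + C w))); last by rewrite ler_wpM2l// expR_ge1Dx.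
rewrite mulrDr mulr1 lerD2l; apply: le_trans (ler_wpM2l (g0 w) (hC w fw)).
rewrite mulr_sumr /S2; apply: ler_sum => x _; rewrite mulr_sumr; apply: ler_sum => a _.
by rewrite mulrDr !mulrA.
Qed.

End Round.

(* The majorant of [expR (U t)] is affine in the observed indicators and losses,
   so the protocol gives its conditional mean. *)
Lemma concentration (al be : nat -> X -> Act -> Om -> R) (U C : nat -> Om -> R) (i : R) :
  (forall t, (1 <= t <= T)%N ->
    [/\ forall x a, a \in acts x -> bmeas (F t.-1) (al t x a),
        forall x a, a \in acts x -> bmeas (F t.-1) (be t x a),
        bmeas (F t) (U t) & bmeas (F t.-1) (C t)]) ->
  (forall t w, (1 <= t <= T)%N -> expR (U t w) <= 1 + \sum_x \sum_(a in acts x)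
       (al t x a w * ind t x a w + be t x a w * (ind t x a w * loss t x w))) ->
  (forall t w, (1 <= t <= T)%N -> flow_set t w -> \sum_x \sum_(a in acts x)
       (al t x a w * (p t x w * plan_a ms x a) + be t x a w * (p t x w * plan_a ms x a * l t x a w))
       <= C t w) ->
  exists B, [/\ measurable B, (P B <= (expR (- i))%:E)%E &
    forall w, ~ B w -> (forall t, (1 <= t <= T)%N -> flow_set t w) ->
      \sum_(1 <= t < T.+1) (U t w - C t w) <= i].
Proof.
move=> bm hU hC; apply: (exp_supermartingale (F := F)) => //.
- by move=> t /bm [].
- by move=> t /bm [].
- by move=> t /flow_setP [].
move=> t g tT bg g0 gF; have [bal bbe bU bC] := bm t tT.
by apply: (exp_step tT bal bbe) => // w; [exact: hU|exact: hC].
Qed.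

(** * Deviation bounds and regret of LocalOMD *)

Section OMD.
Variables (eta : R) (mu : nat -> Om -> X -> Act -> R) (q : nat -> nat -> Om -> R).
Hypothesis eta0 : 0 < eta.

Local Notation kap := (kappa depth acts parent ms).
Local Notation kap_at := (kappa_at depth acts parent ms).

Hypothesis Homd : localOMD H depth acts F T ms (fun _ x => eta / kap_at x) xs as_ ls mu q.

Lemma omd_policy t w : (1 <= t <= T.+1)%N -> policy acts (mu t w).
Proof. by case: Homd => _ h _ _ _; apply: h. Qed.

(** With constant rates the coefficient of the divergence to the initial policy is 0, and each
    update is a plain entropic step. *)
Lemma omd_step t w : (1 <= t <= T)%N ->
  (forall h, (1 <= h <= H)%N ->
   let obj p := \sum_(a in acts (xs t h w))
        loss_est ms (xs t h w) (as_ t h w) (ls t h w) (q t h.+1 w) a * p a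
      + (eta / kap_at (xs t h w))^-1 * bregman_kl (acts (xs t h w)) p (mu t w (xs t h w)) in
   [/\ in_simplex (acts (xs t h w)) (mu t.+1 w (xs t h w)),
      forall p, in_simplex (acts (xs t h w)) p -> obj (mu t.+1 w (xs t h w)) <= obj p &
      q t h w = obj (mu t.+1 w (xs t h w))]) /\
  (forall x, x != xs t (depth x) w -> forall a, a \in acts x -> mu t.+1 w x a = mu t w x a).
Proof.
move=> tT; have [_ _ _ _ /(_ t w tT) [h1 h2]] := Homd; split=> // h hH obj.
have E p0 : omd_obj (acts (xs t h w))
    (loss_est ms (xs t h w) (as_ t h w) (ls t h w) (q t h.+1 w))
    (eta / kap_at (xs t h w)) (eta / kap_at (xs t h w)) (mu t w (xs t h w)) (mu 1%N w (xs t h w)) p0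
    = obj p0 by rewrite /omd_obj subrr mul0r addr0.
have [s1 s2 s3] := h1 h hH; split=> //.
  by move=> p0 sp; have := s2 p0 sp; rewrite !E.
by rewrite s3 E.
Qed.

Lemma omd_q t w : (1 <= t <= T)%N -> q t H.+1 w = 0.
Proof. by move=> tT; case: Homd => _ _ _ h _; exact: h. Qed.

Lemma omd_positive t w : (1 <= t <= T.+1)%N -> positive_policy acts (mu t w).
Proof.
elim: t => // -[|t] IH tT.
  split; first exact: omd_policy.
  move=> x a ax; have [h _ _ _ _] := Homd; rewrite h// invr_gt0 ltr0n card_gt0.
  by apply/set0Pn; exists a.
have t1 : (1 <= t.+1 <= T)%N by [].
have [h1 h2] := omd_step w t1.
apply: (round_positive Hgame Hms (episode_path t1 w) eta0 (IH (ltnW tT)) (episode_loss t1 w)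
  (omd_q w t1) h1 h2).
exact: omd_policy.
Qed.

(** [rsum] and [lsum] at [mu t w] are Z^t and Zhat^t. At a fixed or predictable policy, [lsum] is
    the importance-weighted unbiased estimate of [mloss], the inner product of l^t with the plan. *)
Definition ratio (m : X -> Act -> R) x a := plan_a m x a / plan_a ms x a.
Definition rsum t w (m : X -> Act -> R) := \sum_(1 <= h < H.+1) ratio m (xs t h w) (as_ t h w).
Definition lsum t w (m : X -> Act -> R) :=
  \sum_(1 <= h < H.+1) ratio m (xs t h w) (as_ t h w) * ls t h w.
Definition mloss t w (m : X -> Act -> R) :=
  \sum_x \sum_(a in acts x) p t x w * l t x a w * plan_a m x a.

Lemma ratio_ge0 m x a : policy acts m -> a \in acts x -> 0 <= ratio m x a.
Proof.
move=> pm ax; rewrite divr_ge0 ?(ltW (plan_a_gt0 Hgame Hms ax))//.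
by have /andP[] := plan_a01 Hgame pm ax.
Qed.

Section FixedRound.
Variable t : nat.
Hypothesis tT : (1 <= t <= T)%N.

Lemma rsum_ge0 w m : policy acts m -> 0 <= rsum t w m.
Proof.
move=> pm; rewrite /rsum big_nat_cond; apply: sumr_ge0 => h /andP[hH _].
by have [_ ah] := episode_path tT w hH; exact: ratio_ge0.
Qed.

Lemma lsum_ge0 w m : policy acts m -> 0 <= lsum t w m.
Proof.
move=> pm; rewrite /lsum big_nat_cond; apply: sumr_ge0 => h /andP[hH _].
have [_ ah] := episode_path tT w hH; rewrite mulr_ge0 ?ratio_ge0//.
by have /andP[] := episode_loss tT w hH.
Qed.

Lemma lsum_le w m : policy acts m -> lsum t w m <= rsum t w m.
Proof.
move=> pm; rewrite /lsum /rsum big_nat_cond [leRHS]big_nat_cond; apply: ler_sum => h /andP[hH _].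
have [_ ah] := episode_path tT w hH; rewrite ler_piMr ?ratio_ge0//.
by have /andP[] := episode_loss tT w hH.
Qed.

Lemma rsum_le w m : policy acts m -> rsum t w m <= kap.
Proof.
move=> pm; apply: le_trans (kappa_ge Hgame Hms pm).
apply: (path_sum_le Hgame (episode_path tT w)) => x a ax; exact: ratio_ge0.
Qed.

Lemma rsumE w m : rsum t w m = \sum_x \sum_(a in acts x) ratio m x a * ind t x a w.
Proof.
rewrite /rsum -(path_sum Hgame (episode_path tT w)).
by apply: eq_bigr => x _; apply: eq_bigr => a _; rewrite mulrC.
Qed.

Lemma lsumE w m :
  lsum t w m = \sum_x \sum_(a in acts x) ratio m x a * (ind t x a w * loss t x w).
Proof.
pose f x a := ratio m x a * loss t x w.
have -> : lsum t w m = \sum_(1 <= h < H.+1) f (xs t h w) (as_ t h w).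
  rewrite /lsum big_nat_cond [RHS]big_nat_cond; apply: eq_bigr => h /andP[hH _].
  by have [dh _] := episode_path tT w hH; rewrite /f dh.
rewrite -(path_sum Hgame (episode_path tT w)).
by apply: eq_bigr => x _; apply: eq_bigr => a _; rewrite /f mulrCA.
Qed.

Lemma ratioK m x a : a \in acts x -> ratio m x a * plan_a ms x a = plan_a m x a.
Proof. by move=> ax; rewrite divfK// gt_eqF// (plan_a_gt0 Hgame Hms ax). Qed.

Lemma flow_rsum w m : policy acts m -> flow_set t w ->
  \sum_x \sum_(a in acts x) ratio m x a * (p t x w * plan_a ms x a) <= H%:R.
Proof.
move=> pm fw; apply: le_trans (flow_sum Hgame pm fw).
apply: ler_sum => x _; apply: ler_sum => a ax.
by rewrite mulrCA ratioK.
Qed.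

Lemma mlossE w m :
  \sum_x \sum_(a in acts x) ratio m x a * (p t x w * plan_a ms x a * l t x a w) = mloss t w m.
Proof.
apply: eq_bigr => x _; apply: eq_bigr => a ax.
by rewrite -(ratioK m ax); ring.
Qed.

Lemma mloss_ge0 w m : policy acts m -> 0 <= mloss t w m.
Proof.
move=> pm; apply: sumr_ge0 => x _; apply: sumr_ge0 => a ax.
have /andP[p0 _] := HpV (nu t w) x; have /andP[l0 _] := HlV (nu t w) x a.
by have /andP[m0 _] := plan_a01 Hgame pm ax; apply: mulr_ge0 => //; exact: mulr_ge0.
Qed.

Lemma mloss_le w m : policy acts m -> flow_set t w -> mloss t w m <= H%:R.
Proof.
move=> pm fw; apply: le_trans (flow_sum Hgame pm fw).
apply: ler_sum => x _; apply: ler_sum => a ax; rewrite mulrAC ler_piMr//.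
  have /andP[p0 _] := HpV (nu t w) x; have /andP[m0 _] := plan_a01 Hgame pm ax.
  by rewrite mulr_ge0.
by have /andP[] := HlV (nu t w) x a.
Qed.

Lemma bmeas_mu x a : a \in acts x -> bmeas (F t.-1) (fun w => mu t w x a).
Proof.
move=> ax; have [_ _ h _ _] := Homd; apply: bmeasP (F_sigma _) (h t x a tT) _.
exists 1 => w; have tT' : (1 <= t <= T.+1)%N by case/andP: tT => -> /leqW.
by have /andP[m0 m1] := policy01 (omd_policy w tT') ax; rewrite ger0_norm.
Qed.

Lemma bmeas_ratio x a : a \in acts x -> bmeas (F t.-1) (fun w => ratio (mu t w) x a).
Proof.
move=> ax; apply: bmeasM (bmeas_cst _ _); apply: bmeasM (bmeas_mu ax).
have -> : (fun w => plan (mu t w) x) = (fun w => \prod_(z <- hist depth parent x |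
    z \in hist depth parent x) mu t w z.1 z.2).
  by apply/funext => w; rewrite /real_plan big_seq.
by apply: bmeas_prod => z /(hist_acts Hgame) /bmeas_mu.
Qed.

Lemma bmeas_rsum : bmeas (F t) (fun w => rsum t w (mu t w)).
Proof.
have sub : F t.-1 `<=` F t by apply: filtration_le => //; exact: leq_pred.
under eq_fun do rewrite rsumE.
apply: bmeas_sum => x _; apply: bmeas_sum => a ax; apply: bmeasM.
  exact: bmeas_sub sub (bmeas_ratio ax).
exact: bmeas_visited.
Qed.

Lemma bmeas_lsum : bmeas (F t) (fun w => lsum t w (mu t w)).
Proof.
have sub : F t.-1 `<=` F t by apply: filtration_le => //; exact: leq_pred.
under eq_fun do rewrite lsumE.
apply: bmeas_sum => x _; apply: bmeas_sum => a ax; apply: bmeasM.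
  exact: bmeas_sub sub (bmeas_ratio ax).
by apply: bmeasM; [exact: bmeas_visited|exact: bmeas_loss].
Qed.

Lemma bmeas_mloss : bmeas (F t.-1) (fun w => mloss t w (mu t w)).
Proof.
under eq_fun do rewrite -mlossE.
apply: bmeas_sum => x _; apply: bmeas_sum => a ax; apply: bmeasM; first exact: bmeas_ratio.
by apply: bmeasM (bmeas_l tT x a); apply: bmeasM (bmeas_p tT x) (bmeas_cst _ _).
Qed.

End FixedRound.

Let mup t w (tT : (1 <= t <= T)%N) : policy acts (mu t w).
Proof. by apply: omd_policy; case/andP: tT => -> /leqW. Qed.

Hypothesis kap0 : 0 < kap.

(** Only underestimation of the learner's loss matters, so the exponent is [- lam * lsum] and every
    [lam > 0] is allowed. The quadratic term is linearised by [lsum ^+ 2 <= kap * rsum], and [rsum]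
    has conditional mean at most [H]. *)
Lemma conc_loss (lam i : R) : 0 < lam ->
  exists B, [/\ measurable B, (P B <= (expR (- i))%:E)%E &
    forall w, ~ B w -> (forall t, (1 <= t <= T)%N -> flow_set t w) ->
      \sum_(1 <= t < T.+1) (mloss t w (mu t w) - lsum t w (mu t w))
        <= i / lam + lam / 2 * kap * H%:R * T%:R].
Proof.
move=> lam0.
have [|t w tT|t w tT fw|B [mB PB hB]] := @concentration
   (fun t x a w => lam ^+ 2 / 2 * kap * ratio (mu t w) x a)
   (fun t x a w => - lam * ratio (mu t w) x a)
   (fun t w => - lam * lsum t w (mu t w))
   (fun t w => - lam * mloss t w (mu t w) + lam ^+ 2 / 2 * kap * H%:R) i.
- move=> t tT; split => [x a ax|x a ax||].
  + by apply: bmeasM (bmeas_cst _ _) _; exact: bmeas_ratio.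
  + by apply: bmeasM (bmeas_cst _ _) _; exact: bmeas_ratio.
  + by apply: bmeasM (bmeas_cst _ _) _; exact: bmeas_lsum.
  + by apply: bmeasD (bmeas_cst _ _); apply: bmeasM (bmeas_cst _ _) _; exact: bmeas_mloss.
- have -> : \sum_x \sum_(a in acts x) (lam ^+ 2 / 2 * kap * ratio (mu t w) x a * ind t x a w +
     - lam * ratio (mu t w) x a * (ind t x a w * loss t x w)) =
     lam ^+ 2 / 2 * kap * rsum t w (mu t w) - lam * lsum t w (mu t w).
    rewrite rsumE// lsumE// !mulr_sumr -sumrB; apply: eq_bigr => x _.
    by rewrite !mulr_sumr -sumrB; apply: eq_bigr => a _; ring.
  have l0 := lsum_ge0 tT w (mup w tT); have l1 := lsum_le tT w (mup w tT).
  have r1 := rsum_le tT w (mup w tT).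
  have := @expRN_le2 R (lam * lsum t w (mu t w)); rewrite mulr_ge0 ?(ltW lam0)// mulNr => /(_ isT) h.
  apply: le_trans h _.
  have : lsum t w (mu t w) ^+ 2 <= kap * rsum t w (mu t w).
    by rewrite expr2 ler_pM// (le_trans l1).
  move=> /(ler_wpM2l (_ : 0 <= lam ^+ 2 / 2)); rewrite divr_ge0 ?sqr_ge0// => /(_ isT).
  rewrite exprMn; lra.
- have := flow_rsum (mup w tT) fw => hf.
  have -> : \sum_x \sum_(a in acts x) (lam ^+ 2 / 2 * kap * ratio (mu t w) x a * (p t x w * plan_a ms x a) +
     - lam * ratio (mu t w) x a * (p t x w * plan_a ms x a * l t x a w)) =
     lam ^+ 2 / 2 * kap * (\sum_x \sum_(a in acts x) ratio (mu t w) x a * (p t x w * plan_a ms x a))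
       - lam * mloss t w (mu t w).
    rewrite -mlossE !mulr_sumr -sumrB; apply: eq_bigr => x _.
    by rewrite !mulr_sumr -sumrB; apply: eq_bigr => a _; ring.
  rewrite addrC mulNr lerD2l ler_wpM2l//.
  by rewrite mulr_ge0 ?(ltW kap0)// divr_ge0 ?sqr_ge0.
exists B; split => // w nB fw; have := hB w nB fw.
rewrite [X in X <= i -> _](_ : _ =
   lam * (\sum_(1 <= t < T.+1) (mloss t w (mu t w) - lsum t w (mu t w)))
   - T%:R * (lam ^+ 2 / 2 * kap * H%:R)).
  set S := \sum_(1 <= t < T.+1) _ => h.
  rewrite -(ler_pM2l lam0) (_ : lam * (i / lam + _) = i + T%:R * (lam ^+ 2 / 2 * kap * H%:R)).
    by lra.
  by field; rewrite gt_eqF.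
have -> : T%:R * (lam ^+ 2 / 2 * kap * H%:R) =
    \sum_(1 <= t < T.+1) (lam ^+ 2 / 2 * kap * H%:R) by rewrite sumr_const_nat subn1 mulr_natl.
by rewrite mulr_sumr -sumrB; apply: eq_bigr => t _; ring.
Qed.

(** Scaled by [kap^-1], the sum [rsum] lies in [0,1], where [expR y <= 1 + y + y ^+ 2 <= 1 + 2 * y];
    hence the factor 2. *)
Lemma conc_ratio (i : R) :
  exists B, [/\ measurable B, (P B <= (expR (- i))%:E)%E &
    forall w, ~ B w -> (forall t, (1 <= t <= T)%N -> flow_set t w) ->
      \sum_(1 <= t < T.+1) rsum t w (mu t w) <= 2 * H%:R * T%:R + kap * i].
Proof.
have [|t w tT|t w tT fw|B [mB PB hB]] := @concentration
   (fun t x a w => 2 / kap * ratio (mu t w) x a) (fun _ _ _ _ => 0)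
   (fun t w => kap^-1 * rsum t w (mu t w)) (fun t w => 2 / kap * H%:R) i.
- move=> t tT; split => [x a ax|x a ax||].
  + by apply: bmeasM (bmeas_cst _ _) _; exact: bmeas_ratio.
  + exact: bmeas_cst.
  + by apply: bmeasM (bmeas_cst _ _) _; exact: bmeas_rsum.
  + exact: bmeas_cst.
- have -> : \sum_x \sum_(a in acts x) (2 / kap * ratio (mu t w) x a * ind t x a w +
     0 * (ind t x a w * loss t x w)) = 2 * (kap^-1 * rsum t w (mu t w)).
    rewrite rsumE// !mulr_sumr; apply: eq_bigr => x _.
    by rewrite !mulr_sumr; apply: eq_bigr => a _; ring.
  set y := kap^-1 * _.
  have y0 : 0 <= y by rewrite mulr_ge0 ?invr_ge0 ?(ltW kap0)// rsum_ge0//; exact: mup.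
  have y1 : y <= 1 by rewrite /y ler_pdivrMl// mulr1 rsum_le//; exact: mup.
  have := @expR_le2 R y; rewrite y0 y1 => /(_ isT) h; apply: le_trans h _.
  have : y * y <= y by rewrite ler_piMr.
  rewrite expr2; lra.
- have -> : \sum_x \sum_(a in acts x) (2 / kap * ratio (mu t w) x a * (p t x w * plan_a ms x a) +
     0 * (p t x w * plan_a ms x a * l t x a w)) =
     2 / kap * (\sum_x \sum_(a in acts x) ratio (mu t w) x a * (p t x w * plan_a ms x a)).
    rewrite !mulr_sumr; apply: eq_bigr => x _.
    by rewrite !mulr_sumr; apply: eq_bigr => a _; ring.
  rewrite ler_wpM2l ?divr_ge0 ?(ltW kap0)//; apply: flow_rsum => //; exact: mup.
exists B; split => // w nB fw; have := hB w nB fw.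
rewrite sumrB -mulr_sumr sumr_const_nat subn1 /= -mulr_natr => h.
have := ler_wpM2l (ltW kap0) h; set S := \sum_(1 <= t < T.+1) _.
rewrite (_ : kap * (kap^-1 * S - _) = S - 2 * H%:R * T%:R); first by lra.
by field; rewrite gt_eqF.
Qed.

(** [gam <= 1] keeps the exponent in the range of [expR_le2]; the quadratic term is at most
    [gam ^+ 2] times the indicator. *)
Lemma conc_visited (gam i : R) x0 a0 : 0 < gam <= 1 -> a0 \in acts x0 ->
  exists B, [/\ measurable B, (P B <= (expR (- i))%:E)%E &
    forall w, ~ B w -> (forall t, (1 <= t <= T)%N -> flow_set t w) ->
      \sum_(1 <= t < T.+1) ind t x0 a0 w * loss t x0 w <=
      i / gam + \sum_(1 <= t < T.+1)
         (p t x0 w * plan_a ms x0 a0 * l t x0 a0 w + gam * (p t x0 w * plan_a ms x0 a0))].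
Proof.
move=> /andP[gam0 gam1] ax0.
pose sel (x : X) (a : Act) : R := ((x == x0) && (a == a0))%:R.
have selE (f : X -> Act -> R) : \sum_x \sum_(a in acts x) sel x a * f x a = f x0 a0.
  rewrite (bigD1 x0)//= [X in _ + X]big1 ?addr0 => [|x /negPf xy]; last first.
    by apply: big1 => a _; rewrite /sel xy mul0r.
  rewrite (bigD1 a0)//= [X in _ + X]big1 ?addr0 => [|a /andP[_ /negPf ab]]; last first.
    by rewrite /sel ab andbF mul0r.
  by rewrite /sel !eqxx mul1r.
have [|t w tT|t w tT fw|B [mB PB hB]] := @concentration
   (fun t x a w => gam ^+ 2 * sel x a) (fun t x a w => gam * sel x a)
   (fun t w => gam * (ind t x0 a0 w * loss t x0 w))
   (fun t w => gam * (p t x0 w * plan_a ms x0 a0 * l t x0 a0 w + gam * (p t x0 w * plan_a ms x0 a0))) i.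
- move=> t tT; have bp : bmeas (F t.-1) (fun w => p t x0 w * plan_a ms x0 a0).
    by apply: bmeasM (bmeas_p tT x0) (bmeas_cst _ _).
  split => [x a ax|x a ax||].
  + exact: bmeas_cst.
  + exact: bmeas_cst.
  + apply: bmeasM (bmeas_cst _ _) _; apply: bmeasM; first exact: bmeas_visited.
    exact: bmeas_loss.
  + apply: bmeasM (bmeas_cst _ _) _; apply: bmeasD; last exact: bmeasM (bmeas_cst _ _) _.
    by apply: bmeasM => //; exact: bmeas_l.
- rewrite (_ : \sum_x _ = gam ^+ 2 * ind t x0 a0 w + gam * (ind t x0 a0 w * loss t x0 w)); last first.
    rewrite -(selE (fun x a => gam ^+ 2 * ind t x a w + gam * (ind t x a w * loss t x w))).
    by apply: eq_bigr => x _; apply: eq_bigr => a _; ring.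
  have /andP[l0 l1] := episode_loss tT w (depth_itv Hgame x0).
  rewrite /visited; case: (_ && _); last by rewrite !(mul0r, mulr0, expR0, addr0).
  rewrite mul1r mulr1; have := @expR_le2 R (gam * loss t x0 w).
  rewrite mulr_ge0 ?(ltW gam0)// mulr_ile1 ?(ltW gam0)// => /(_ isT) h; apply: le_trans h _.
  have : gam ^+ 2 * loss t x0 w ^+ 2 <= gam ^+ 2.
    by rewrite ler_piMr ?sqr_ge0// expr_le1.
  rewrite exprMn; lra.
- rewrite le_eqVlt; apply/orP; left; apply/eqP.
  rewrite -(selE (fun x a => gam * (p t x w * plan_a ms x a * l t x a w + gam * (p t x w * plan_a ms x a)))).
  by apply: eq_bigr => x _; apply: eq_bigr => a _; ring.
exists B; split => // w nB fw; have := hB w nB fw.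
rewrite sumrB -!mulr_sumr -mulrBr -ler_pdivlMl// => h.
rewrite mulrC; lra.
Qed.

(** The divergences telescope over rounds: the final one is nonnegative and the initial one, to the
    uniform policy, is at most [ln (Amax acts)]. Their weights sum to at most [H * kap] by
    [kappa_sum]. *)
Lemma omd_regret w (md : X -> Act -> R) : (2 <= Amax acts)%N -> policy acts md ->
  \sum_(1 <= t < T.+1) (lsum t w (mu t w) - lsum t w md) <=
  eta / 2 * H%:R * (\sum_(1 <= t < T.+1) rsum t w (mu t w))
    + H%:R * kap * ln (Amax acts)%:R / eta.
Proof.
move=> HA pmd.
pose D t x := bregman_kl (acts x) (md x) (mu t w x).
apply: (@le_trans _ _ (\sum_(1 <= t < T.+1) (eta / 2 * H%:R * rsum t w (mu t w)
    + \sum_x plan md x / plan ms x * (kap_at x / eta * (D t x - D t.+1 x))))).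
  rewrite big_nat_cond [leRHS]big_nat_cond; apply: ler_sum => t /andP[tT _].
  have [h1 h2] := omd_step w tT.
  have tT' : (1 <= t <= T.+1)%N by case/andP: tT => -> /leqW.
  exact: (round_bound Hgame Hms (episode_path tT w) (fun h => @episode_child t tT w h) eta0
    (omd_positive w tT') (episode_loss tT w) (omd_q w tT) h1 h2 pmd).
rewrite big_split /= -mulr_sumr lerD2l exchange_big /=.
apply: (@le_trans _ _ (\sum_x plan md x / plan ms x * kap_at x * (ln (Amax acts)%:R / eta))).
  apply: ler_sum => x _; rewrite -!mulr_sumr.
  have w0 : 0 <= plan md x / plan ms x.
    rewrite divr_ge0 ?(ltW (plan_gt0 Hgame _ Hms))//.
    by have /andP[] := plan01 Hgame x pmd.
  rewrite -[leRHS]mulrA ler_wpM2l// -[leLHS]mulrA ler_wpM2l ?(ltW (kappa_at_gt0 Hgame Hms x))//.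
  rewrite mulrC ler_wpM2r ?invr_ge0 ?(ltW eta0)//.
  have -> : \sum_(1 <= t < T.+1) (D t x - D t.+1 x) = D 1%N x - D T.+1 x.
    by rewrite -[RHS]opprB -(@telescope_sumr _ 1 T.+1 (fun t => D t x))// -sumrN; apply: eq_bigr => t _; rewrite opprB.
  have DT : 0 <= D T.+1 x.
    have [pT pT0] : positive_policy acts (mu T.+1 w) by apply: omd_positive; rewrite leqnn.
    exact: (bregman_kl_ge0 (pmd x) (pT x) (fun a => pT0 x a)).
  have D1 : D 1%N x <= ln #|acts x|%:R.
    apply: bregman_kl_uniform => //; first by apply: omd_policy.
    by move=> a ax; have [h _ _ _ _] := Homd; exact: h.
  apply: le_trans (_ : ln #|acts x|%:R <= _); first by lra.
  have [a ax] := acts_neq0 Hgame x.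
  have c0 : (0 < #|acts x|)%N by rewrite card_gt0; apply/set0Pn; exists a.
  rewrite ler_ln ?posrE ?ltr0n//; last by apply: leq_trans HA.
  by rewrite ler_nat /Amax; exact: (leq_bigmax x).
rewrite -mulr_suml -mulrA ler_wpM2r ?(kappa_sum Hgame Hms)//.
by rewrite divr_ge0 ?(ltW eta0)// ln_ge0// ler1n; exact: ltnW.
Qed.

(** The bounds per pair are combined with the nonnegative weights [ratio md]: the constants
    [i / gam] cost a factor [kap], the corrections at most [gam * H] per round. *)
Lemma comparator_bound w (md : X -> Act -> R) (gam i : R) : 0 < gam -> 0 <= i ->
  policy acts md -> (forall t, (1 <= t <= T)%N -> flow_set t w) ->
  (forall x a, a \in acts x ->
     \sum_(1 <= t < T.+1) ind t x a w * loss t x w <=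
      i / gam + \sum_(1 <= t < T.+1)
         (p t x w * plan_a ms x a * l t x a w + gam * (p t x w * plan_a ms x a))) ->
  \sum_(1 <= t < T.+1) lsum t w md <=
  \sum_(1 <= t < T.+1) mloss t w md + (i / gam * kap + gam * H%:R * T%:R).
Proof.
move=> gam0 i0 pmd fw hv.
have -> : \sum_(1 <= t < T.+1) lsum t w md = \sum_x \sum_(a in acts x)
    ratio md x a * \sum_(1 <= t < T.+1) ind t x a w * loss t x w.
  transitivity (\sum_(1 <= t < T.+1) \sum_x \sum_(a in acts x) ratio md x a * (ind t x a w * loss t x w)).
    by rewrite big_nat_cond [RHS]big_nat_cond; apply: eq_bigr => t /andP[tT _]; rewrite lsumE.
  rewrite exchange_big /=; apply: eq_bigr => x _.
  by rewrite exchange_big /=; apply: eq_bigr => a _; rewrite mulr_sumr.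
apply: (@le_trans _ _ (\sum_x \sum_(a in acts x) ratio md x a * (i / gam + \sum_(1 <= t < T.+1)
         (p t x w * plan_a ms x a * l t x a w + gam * (p t x w * plan_a ms x a))))).
  apply: ler_sum => x _; apply: ler_sum => a ax.
  by apply: ler_wpM2l; [exact: ratio_ge0|exact: hv].
have -> : \sum_x \sum_(a in acts x) ratio md x a * (i / gam + \sum_(1 <= t < T.+1)
         (p t x w * plan_a ms x a * l t x a w + gam * (p t x w * plan_a ms x a))) =
   i / gam * (\sum_x \sum_(a in acts x) ratio md x a) +
   \sum_(1 <= t < T.+1) (mloss t w md +
     gam * (\sum_x \sum_(a in acts x) ratio md x a * (p t x w * plan_a ms x a))).
  have E t : mloss t w md + gam * (\sum_x \sum_(a in acts x) ratio md x a * (p t x w * plan_a ms x a))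
    = \sum_x \sum_(a in acts x) ratio md x a *
        (p t x w * plan_a ms x a * l t x a w + gam * (p t x w * plan_a ms x a)).
    rewrite -mlossE mulr_sumr -big_split /=; apply: eq_bigr => x _.
    by rewrite mulr_sumr -big_split /=; apply: eq_bigr => a _; ring.
  rewrite (eq_bigr _ (fun t _ => E t)) exchange_big /= mulr_sumr -big_split /=.
  apply: eq_bigr => x _; rewrite exchange_big /= mulr_sumr -big_split /=.
  by apply: eq_bigr => a _; rewrite mulrDr (mulrC _ (i / gam)) mulr_sumr.
rewrite big_split /= addrCA lerD2l; apply: lerD.
  rewrite ler_wpM2l ?divr_ge0 ?(ltW gam0)//; exact: (kappa_ge Hgame Hms pmd).
apply: (@le_trans _ _ (\sum_(1 <= t < T.+1) gam * H%:R)).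
  rewrite big_nat_cond [leRHS]big_nat_cond; apply: ler_sum => t /andP[tT _].
  by rewrite ler_wpM2l ?(ltW gam0)//; apply: flow_rsum => //; exact: fw.
by rewrite sumr_const_nat subn1 /= -[leLHS]mulr_natr.
Qed.

Lemma innerE t w (md : X -> Act -> R) :
  inner acts (fun x a => p t x w * l t x a w)
    (fun x a => plan_a (mu t w) x a - plan_a md x a) = mloss t w (mu t w) - mloss t w md.
Proof.
rewrite /inner /mloss -sumrB; apply: eq_bigr => x _.
by rewrite -sumrB; apply: eq_bigr => a _; rewrite mulrBr.
Qed.

Lemma regret_le w (c : R) :
  (forall md, policy acts md ->
     \sum_(1 <= t < T.+1) (mloss t w (mu t w) - mloss t w md) <= c) ->
  regret depth acts parent T pV lV nu mu w <= c.
Proof.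
move=> hc; apply: ge_sup; first by eexists; exists ms; split; [exact: (proj1 Hms)|].
move=> _ [md [pmd ->]]; apply: le_trans (hc md pmd).
by rewrite le_eqVlt; apply/orP; left; apply/eqP; apply: eq_bigr => t _; rewrite innerE.
Qed.

Lemma regret_trivial w : (forall t, (1 <= t <= T)%N -> flow_set t w) ->
  regret depth acts parent T pV lV nu mu w <= H%:R * T%:R.
Proof.
move=> fw; apply: regret_le => md pmd.
apply: (@le_trans _ _ (\sum_(1 <= t < T.+1) H%:R)).
  rewrite big_nat_cond [leRHS]big_nat_cond; apply: ler_sum => t /andP[tT _].
  rewrite lerBlDr (le_trans (mloss_le (mup w tT) (fw t tT)))// lerDl.
  exact: mloss_ge0.
by rewrite sumr_const_nat subn1 /= -[leLHS]mulr_natr.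
Qed.

Lemma flow_event : exists B, [/\ measurable B, (P B <= 0)%E &
  forall w, ~ B w -> forall t, (1 <= t <= T)%N -> flow_set t w].
Proof.
have [t|B [mB PB hB]] := @union_bound R d Om P nat (index_iota 1 T.+1)
   (fun t w => flow_set t w) (fun=> 0).
  rewrite mem_index_iota => tT; have [Gf Pf] := flow_setP tT.
  exists (~` flow_set t); split; last by move=> w /contrapT.
  - by apply: measurableC; exact: F_measurable Gf.
  - by rewrite Pf.
exists B; split => // [|w nB t tT]; first by move: PB; rewrite big1.
by apply: hB => //; rewrite mem_index_iota.
Qed.

Lemma visited_event (gam i : R) : 0 < gam <= 1 ->
  exists B, [/\ measurable B, (P B <= ((AX acts)%:R * expR (- i))%:E)%E &
    forall w, ~ B w -> (forall t, (1 <= t <= T)%N -> flow_set t w) ->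
      forall x a, a \in acts x -> \sum_(1 <= t < T.+1) ind t x a w * loss t x w <=
      i / gam + \sum_(1 <= t < T.+1)
         (p t x w * plan_a ms x a * l t x a w + gam * (p t x w * plan_a ms x a))].
Proof.
move=> gam01.
pose s := [seq z <- index_enum (X * Act)%type | z.2 \in acts z.1].
pose Q (z : X * Act) w := (forall t, (1 <= t <= T)%N -> flow_set t w) ->
  \sum_(1 <= t < T.+1) ind t z.1 z.2 w * loss t z.1 w <=
      i / gam + \sum_(1 <= t < T.+1)
         (p t z.1 w * plan_a ms z.1 z.2 * l t z.1 z.2 w + gam * (p t z.1 w * plan_a ms z.1 z.2)).
have [z|B [mB PB hB]] := @union_bound R d Om P (X * Act)%type s Q (fun=> expR (- i)).
  by rewrite mem_filter => /andP[az _]; exact: conc_visited.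
exists B; split => //.
  move: PB; rewrite big_filter -(pair_big_dep xpredT (fun x a => a \in acts x) (fun _ _ => expR (- i))) /=.
  under eq_bigr do rewrite sumr_const -mulr_natl.
  by rewrite -mulr_suml -natr_sum.
move=> w nB fw x a ax; apply: (hB w nB (x, a)) => //.
by rewrite mem_filter /= ax mem_index_enum.
Qed.

(** The exceptional sets do not depend on the comparator, so the bound passes to the supremum. They
    number [AX acts] for the pairs and two for the learner. *)
Lemma regret_event (lam gam i : R) : (2 <= Amax acts)%N -> 0 < lam -> 0 < gam <= 1 -> 0 <= i ->
  exists B, [/\ measurable B, (P B <= (((AX acts)%:R + 2) * expR (- i))%:E)%E &
    forall w, ~ B w -> (forall t, (1 <= t <= T)%N -> flow_set t w) ->
      regret depth acts parent T pV lV nu mu w <=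
      i / lam + lam / 2 * kap * H%:R * T%:R
      + (eta / 2 * H%:R * (2 * H%:R * T%:R + kap * i) + H%:R * kap * ln (Amax acts)%:R / eta)
      + (i / gam * kap + gam * H%:R * T%:R)].
Proof.
move=> HA lam0 gam01 i0.
have [B1 [m1 e1 h1]] := conc_loss i lam0.
have [B2 [m2 e2 h2]] := conc_ratio i.
have [B3 [m3 e3 h3]] := visited_event i gam01.
have /andP[gam0 _] := gam01.
exists (B1 `|` B2 `|` B3); split.
- by apply: measurableU => //; exact: measurableU.
- have -> : ((AX acts)%:R + 2) * expR (- i) = expR (- i) + expR (- i) + (AX acts)%:R * expR (- i).
    by ring.
  rewrite !EFinD; apply: le_trans (measureU2 _ _ _) _ => //; first exact: measurableU.
  apply: leeD => //; apply: le_trans (measureU2 _ _ _) _ => //; exact: leeD.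
- move=> w nB fw; have n1 : ~ B1 w by move=> ?; apply: nB; left; left.
  have n2 : ~ B2 w by move=> ?; apply: nB; left; right.
  have n3 : ~ B3 w by move=> ?; apply: nB; right.
  apply: regret_le => md pmd.
  have c1 := h1 w n1 fw; have c2 := h2 w n2 fw.
  have c3 := comparator_bound gam0 i0 pmd fw (h3 w n3 fw).
  have c4 := omd_regret w HA pmd.
  have c5 : eta / 2 * H%:R * (\sum_(1 <= t < T.+1) rsum t w (mu t w)) <=
     eta / 2 * H%:R * (2 * H%:R * T%:R + kap * i).
    by rewrite ler_wpM2l// mulr_ge0// divr_ge0// ltW.
  move: c1 c4; rewrite !sumrB; lra.
Qed.

End OMD.
End Episode.

(** The variables are the square roots of iota, kappa, H, T, log A and 3. [gam] balances its two
    terms; [lam] equates the orders of its two terms, with sum [3 / 2]. *)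
Lemma regret_numeric (R : realFieldType) (i k r tau a u eta lam gam : R) :
  1 <= i -> 0 < k -> 1 <= r -> 0 < tau -> 3 / 4 <= a -> 0 < u -> u ^+ 2 = 3 ->
  i * k <= r * tau ->
  eta = a * k / (u * r * tau) -> lam = i / (k * r * tau) -> gam = i * k / (r * tau) ->
  i ^+ 2 / lam + lam / 2 * k ^+ 2 * r ^+ 2 * tau ^+ 2
  + (eta / 2 * r ^+ 2 * (2 * r ^+ 2 * tau ^+ 2 + k ^+ 2 * i ^+ 2)
     + r ^+ 2 * k ^+ 2 * a ^+ 2 / eta)
  + (i ^+ 2 / gam * k ^+ 2 + gam * r ^+ 2 * tau ^+ 2)
  <= (4 + 2 * u) * (r ^+ 2 * r) * (a * i * k * tau).
Proof.
move=> i1 k0 r1 t0 a34 u0 u3 ik etaE lamE gamE.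
have r0 : 0 < r by lra.
have i0 : 0 < i by lra.
have a0 : 0 < a by lra.
have u43 : 4 / 3 <= u by nra.
have nz (x : R) : 0 < x -> x != 0 by move=> /gt_eqF ->.
have nz_i := nz _ i0; have nz_k := nz _ k0; have nz_r := nz _ r0.
have nz_t := nz _ t0; have nz_a := nz _ a0; have nz_u := nz _ u0.
have eta0 : 0 < eta by rewrite etaE divr_gt0// !mulr_gt0.
have -> : i ^+ 2 / lam + lam / 2 * k ^+ 2 * r ^+ 2 * tau ^+ 2 = 3 / 2 * (i * k * r * tau).
  by rewrite lamE; field; rewrite nz_t nz_r nz_k nz_i.
have -> : i ^+ 2 / gam * k ^+ 2 + gam * r ^+ 2 * tau ^+ 2 = 2 * (i * k * r * tau).
  by rewrite gamE; field; rewrite nz_t nz_r nz_k nz_i.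
have h1 : eta / 2 * r ^+ 2 * (2 * r ^+ 2 * tau ^+ 2 + k ^+ 2 * i ^+ 2) <=
    u / 2 * (r ^+ 2 * r * a * k * tau).
  have e1 : 2 * r ^+ 2 * tau ^+ 2 + k ^+ 2 * i ^+ 2 <= 3 * (r ^+ 2 * tau ^+ 2).
    have ik0 : 0 <= i * k by rewrite ltW// mulr_gt0.
    have : (i * k) * (i * k) <= (r * tau) * (r * tau) by apply: ler_pM.
    lra.
  apply: le_trans (ler_wpM2l _ e1) _; first by rewrite mulr_ge0 ?sqr_ge0// divr_ge0 ?(ltW eta0).
  rewrite le_eqVlt; apply/orP; left; apply/eqP.
  by rewrite etaE -u3; field; rewrite nz_t nz_r nz_u.
have h2 : r ^+ 2 * k ^+ 2 * a ^+ 2 / eta = u * (r ^+ 2 * r * a * k * tau).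
  by rewrite etaE; field; rewrite nz_t nz_r nz_u nz_k nz_a.
rewrite h2.
have kt0 : 0 < k * tau by rewrite mulr_gt0.
have g1 : i * k * r * tau <= 4 / 3 * (r ^+ 2 * r * (a * i * k * tau)).
  have -> : i * k * r * tau = (i * (k * tau) * r) * 1 by ring.
  have -> : 4 / 3 * (r ^+ 2 * r * (a * i * k * tau)) = (i * (k * tau) * r) * (r ^+ 2 * (4 / 3 * a)) by field.
  rewrite ler_pM2l ?mulr_gt0// -[leLHS]mulr1 ler_pM//; first by rewrite expr_ge1// ltW.
  lra.
have g2 : r ^+ 2 * r * a * k * tau <= r ^+ 2 * r * (a * i * k * tau).
  have -> : r ^+ 2 * r * a * k * tau = (r ^+ 2 * r * a * (k * tau)) * 1 by ring.
  have -> : r ^+ 2 * r * (a * i * k * tau) = (r ^+ 2 * r * a * (k * tau)) * i by ring.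
  by rewrite ler_pM2l// !mulr_gt0// exprn_gt0.
set Y := r ^+ 2 * r * (a * i * k * tau) in g1 g2 *.
have Y0 : 0 <= Y by rewrite /Y !mulr_ge0 ?sqr_ge0 ?ltW.
have -> : (4 + 2 * u) * (r ^+ 2 * r) * (a * i * k * tau) = (4 + 2 * u) * Y by rewrite /Y; ring.
have h3 : u / 2 * (r ^+ 2 * r * a * k * tau) + u * (r ^+ 2 * r * a * k * tau) <= 3 / 2 * (u * Y).
  rewrite -mulrDl (_ : u / 2 + u = 3 / 2 * u); last by field.
  by rewrite -[leLHS]mulrA ler_wpM2l ?divr_ge0// ler_wpM2l// ltW.
(* The deviation terms cost [3 / 2 + 2 = 7 / 2] times [4 / 3], that is [14 / 3], and the learning
   terms [3 / 2 * u]. The total is at most [4 + 2 * u] because [2 / 3 <= u / 2]. *)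
have : 4 / 3 * Y <= u * Y by rewrite ler_wpM2r.
lra.
Qed.

Theorem theorem4
  (X Act : finType) (H : nat) (depth : X -> nat) (acts : X -> {set Act})
  (parent : X -> option (X * Act))
  (Hgame : wf_game H depth acts parent)
  (HA : (2 <= Amax acts)%N)
  (R : realType) (ms : X -> Act -> R) (Hms : positive_policy acts ms)
  (T : nat) (HT : (0 < T)%N)
  (d : measure_display) (Om : measurableType d) (P : probability Om R)
  (F : nat -> set (set Om)) (HF : filtration F)
  (V : Type) (pV : V -> X -> R) (lV : V -> X -> Act -> R)
  (HpV : forall v x, 0 <= pV v x <= 1)
  (HlV : forall v x a, 0 <= lV v x a <= 1)
  (nu : nat -> Om -> V)
  (xs : nat -> nat -> Om -> X) (as_ : nat -> nat -> Om -> Act)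
  (ls : nat -> nat -> Om -> R)
  (Hproto : protocol H depth acts parent P F T pV lV nu ms xs as_ ls)
  (mu : nat -> Om -> X -> Act -> R) (q : nat -> nat -> Om -> R) :
  let eta := Num.sqrt (ln (Amax acts)%:R * kappa depth acts parent ms
                       / (3 * H%:R * T%:R)) in
  let lr := fun (t : nat) (x : X) => eta / kappa_at depth acts parent ms x in
  localOMD H depth acts F T ms lr xs as_ ls mu q ->
  forall delta : R, 0 < delta < 1 ->
  let iota := ln (2 * ((AX acts)%:R + 1) / delta) in
  exists E : set Om, measurable E /\ ((1 - delta)%:E <= P E)%E /\
    forall w, E w ->
      regret depth acts parent T pV lV nu mu w <=
        (4 + 2 * Num.sqrt 3) * (H%:R * Num.sqrt H%:R) *
        Num.sqrt (ln (Amax acts)%:R * iota * kappa depth acts parent ms * T%:R).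
Proof.
move=> eta lr Homd delta /andP[delta0 delta1] iota.
pose kap := kappa depth acts parent ms.
pose lnA : R := ln (Amax acts)%:R.
rewrite -/kap -/lnA.
have [H0 _ _ _ _] := Hgame.
have H1R : 1 <= H%:R :> R by rewrite ler1n.
have T0R : 0 < T%:R :> R by rewrite ltr0n.
have AX2 : (2 <= AX acts)%N.
  have [x ax] : exists x, (2 <= #|acts x|)%N.
    apply/existsP; apply: contraLR HA => /existsPn h; rewrite -ltnNge ltnS /Amax.
    by apply/bigmax_leqP => x _; rewrite -ltnS ltnNge.
  by rewrite /AX (bigD1 x)//=; apply: leq_trans ax _; exact: leq_addr.
have AX2R : 2 <= (AX acts)%:R :> R by rewrite ler_nat.
have kap0 : 0 < kap by apply: lt_le_trans (kappa_ge_AX Hgame Hms); lra.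
(* A square just below [ln 2], giving [3 / 4 <= a]; it follows from
   [expR (9 / 16) <= 481 / 256 <= 2]. *)
have lnA916 : 9 / 16 <= lnA.
  apply: (@le_trans _ _ (ln 2)); last by rewrite ler_ln ?posrE ?ltr0n ?ler_nat// ltnW.
  rewrite -ler_expR lnK ?posrE//; have := @expR_le2 R (9 / 16); rewrite expr2; lra.
have iota1 : 1 <= iota.
  have e3 : expR 1 <= 3 :> R by have := @expR_le2 R 1; rewrite expr2; lra.
  have a0 : 0 < 2 * ((AX acts)%:R + 1) / delta by rewrite divr_gt0//; lra.
  rewrite -ler_expR lnK ?posrE//; apply: le_trans e3 _.
  rewrite ler_pdivlMr//; lra.
have expiota : expR (- iota) = delta / (2 * ((AX acts)%:R + 1)).
  by rewrite expRN lnK ?invf_div// posrE divr_gt0//; lra.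
pose i := Num.sqrt iota; pose k := Num.sqrt kap; pose r := Num.sqrt H%:R : R.
pose tau := Num.sqrt T%:R : R; pose a := Num.sqrt lnA; pose u := Num.sqrt 3 : R.
have i2 : i ^+ 2 = iota by rewrite sqr_sqrtr//; lra.
have k2 : k ^+ 2 = kap by rewrite sqr_sqrtr// ltW.
have r2 : r ^+ 2 = H%:R by rewrite sqr_sqrtr.
have t2 : tau ^+ 2 = T%:R by rewrite sqr_sqrtr.
have a2 : a ^+ 2 = lnA by rewrite sqr_sqrtr//; lra.
have u2 : u ^+ 2 = 3 by rewrite sqr_sqrtr.
have i1 : 1 <= i by rewrite -[leLHS]sqrtr1 ler_wsqrtr.
have r1 : 1 <= r by rewrite -[leLHS]sqrtr1 ler_wsqrtr.
have k0 : 0 < k by rewrite sqrtr_gt0.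
have t0 : 0 < tau by rewrite sqrtr_gt0.
have u0 : 0 < u by rewrite sqrtr_gt0.
have a34 : 3 / 4 <= a.
  have -> : 3 / 4 = Num.sqrt (9 / 16) :> R.
    rewrite (_ : 9 / 16 = (3 / 4) ^+ 2 :> R) ?sqrtr_sqr ?ger0_norm//; lra.
  by rewrite ler_wsqrtr.
have i0 : 0 < i by lra.
have r0 : 0 < r by lra.
have a0 : 0 < a by lra.
have etaE : eta = a * k / (u * r * tau).
  rewrite /eta -/kap -/lnA -a2 -k2 -u2 -r2 -t2 -!exprMn -expr_div_n sqrtr_sqr ger0_norm//.
  by rewrite divr_ge0 ?mulr_ge0 ?ltW.
have eta0 : 0 < eta by rewrite etaE divr_gt0// !mulr_gt0.
have -> : Num.sqrt (lnA * iota * kap * T%:R) = a * i * k * tau.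
  rewrite -a2 -i2 -k2 -t2 -!exprMn sqrtr_sqr ger0_norm//.
  by rewrite !mulr_ge0 ?ltW.
rewrite -/r -/u.
have [B0 [m0 e0 h0]] := flow_event Hgame Hms HF HpV HlV Hproto.
(* If [i * k] exceeds [r * tau], then [H * T = (r * tau) ^+ 2] is below [r * tau * (i * k)], which
   the claimed bound dominates. *)
have [ik|ik] := leP (i * k) (r * tau); last first.
  exists (~` B0); split; [exact: measurableC|split].
    rewrite probability_setC//.
    have -> : P B0 = 0%E by apply/eqP; rewrite eq_le e0 measure_ge0.
    by rewrite sube0 lee_fin lerBlDr lerDl ltW.
  move=> w nB.
  apply: le_trans (regret_trivial Hgame Hms HpV HlV Homd (h0 w nB)) _.
  rewrite -r2 -t2 expr2 expr2.
  have h1 : r * tau * (r * tau) <= r * tau * (i * k) by rewrite ler_wpM2l ?ltW// mulr_gt0.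
  have h2 : 0 < r * tau * (i * k) by rewrite !mulr_gt0.
  have h3 : 1 <= (4 + 2 * u) * (r * r * a).
    have : 1 * (3 / 4) <= r * r * a by apply: ler_pM; rewrite ?divr_ge0//; nra.
    have := ltW u0; nra.
  have h4 : r * tau * (i * k) * 1 <= r * tau * (i * k) * ((4 + 2 * u) * (r * r * a)).
    by rewrite ler_wpM2l// ltW.
  lra.
have lam0 : 0 < i / (k * r * tau) by rewrite divr_gt0// !mulr_gt0.
have gam01 : 0 < i * k / (r * tau) <= 1.
  by rewrite divr_gt0 ?mulr_gt0//= ler_pdivrMr ?mul1r// mulr_gt0.
have [B1 [m1 e1 h1]] := regret_event Hgame Hms HF HpV HlV Hproto eta0 Homd kap0 HA lam0 gam01
  (le_trans ler01 iota1).
exists (~` (B0 `|` B1)); split; [by apply: measurableC; exact: measurableU|split].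
  rewrite probability_setC; last exact: measurableU.
  rewrite EFinB leeB//; apply: le_trans (measureU2 _ _ _) _ => //.
  apply: le_trans (leeD e0 e1) _; rewrite add0e lee_fin expiota.
  (* The failure probability is at most [delta] because [AX + 2 <= 2 * (AX + 1)]. *)
  rewrite mulrA ler_pdivrMr; last by lra.
  nra.
move=> w nB; have n0 : ~ B0 w by move=> ?; apply: nB; left.
have n1 : ~ B1 w by move=> ?; apply: nB; right.
apply: le_trans (h1 w n1 (h0 w n0)) _.
rewrite -/lnA -/kap -i2 -k2 -a2 -r2 -t2.
exact: regret_numeric.
Qed.
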